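(* Let $n,k\ge1$ be integers. Then \begin{align*} S_k(2n) &=(-\pi^2)^{nk}\sum_{\substack{m_1,\ldots,m_n\ge0\\ m_1+\cdots+m_n=nk}}\omega_n^{m_1+2m_2+\dots+nm_n}\frac{B_{2m_1}}{(2m_1)!}\cdots\frac{B_{2m_n}}{(2m_n)!}\\ &=(-\pi^2)^{nk}\sum_{\substack{\lambda\vdash nk\\ \ell(\lambda)\le n}}\langle p_n\circ h_k,\,m_\lambda\rangle\frac{B_{2\lambda}}{(2\lambda)!}\\ &=(-\pi^2)^{nk}\sum_{\mu\vdash k}\frac{\widetilde\nu(2n\mu)}{z_\mu}\frac{B_{2n\mu}}{(2n\mu)!}. \end{align*}
   Context: For positive integers $i,j$ put $\varepsilon_{ij}=0$ if $i=j$ is odd, and $\varepsilon_{ij}=1$ otherwise; put $\varepsilon_{i_1\dots i_k}=\prod_{j=1}^{k-1}\varepsilon_{i_ji_{j+1}}$ (equal to $1$ for $k=1$). The partial alternating multiple zeta values are $$S_k(n)=\sum_{1\le i_1\le i_2\le\dots\le i_k}\varepsilon_{i_1i_2\dots i_k}\frac{(-1)^{i_1+i_2+\dots+i_k}}{i_1^{n}i_2^{n}\cdots i_k^{n}}.$$ $\omega_n$ is a primitive $n$-th root of unity and $B_m$ is the $m$-th Bernoulli number. $\lambda\vdash k$ means that $\lambda$ is a partition of $k$; $\ell(\lambda)$ is the number of its nonzero parts and $m_i(\lambda)$ the multiplicity of $i$ in $\lambda$; $z_\mu=\prod_{i\ge1}i^{m_i(\mu)}m_i(\mu)!$. For a positive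 integer $q$ and a partition $\lambda$: $B_{q\lambda}=\prod_{j=1}^{\ell(\lambda)}B_{q\lambda_j}$, $(q\lambda)!=\prod_{j=1}^{\ell(\lambda)}(q\lambda_j)!$, and $\widetilde\nu(q\lambda)=\prod_{j=1}^{\ell(\lambda)}\widetilde\nu(q\lambda_j)$, where $\widetilde\nu(x)=2^{x-1}-1$. In the ring of symmetric functions in infinitely many variables $x_1,x_2,\dots$: $p_n$ is the $n$-th power-sum, $h_k$ the $k$-th complete symmetric function, $h_\lambda=\prod_i h_{\lambda_i}$, $m_\lambda$ the monomial symmetric function, $\circ$ is plethysm (so $p_n\circ h_k=h_k(x_1^n,x_2^n,\dots)$), and $\langle\cdot,\cdot\rangle$ is the standard scalar product determined by $\langle h_\lambda,m_\mu\rangle=\delta_{\lambda\mu}$. *)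

(* Defs.v *)
From HB Require Import structures.
From mathcomp Require Import all_boot all_order all_algebra.

Set Implicit Arguments.
Unset Strict Implicit.
Unset Printing Implicit Defensive.

Import Order.TTheory GRing.Theory Num.Theory.
Local Open Scope ring_scope.

(* Symmetric functions with rational coefficients in x_0, x_1, ..., as the
   graded inverse limit of the rings of symmetric
   polynomials in N variables: [f N] is f(x_0, ..., x_(N-1), 0, 0, ...).
   The module confines the notations of mpoly, which clash with those of
   MathComp-Analysis.                                                         *)
From mathcomp Require mpoly.

Module SymFun.
Import mpoly.

Definition family := forall N : nat, {mpoly rat[N]}.

Definition restrict N (p : {mpoly rat[N.+1]}) : {mpoly rat[N]} :=
  p \mPo [tuple if unlift ord_max i is Some j then 'X_j else 0 | i < N.+1].

Definition symfun (f : family) : Prop :=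
  [/\ forall N, f N \is symmetric,
      forall N, restrict (f N.+1) = f N
    & exists d, forall N, (msize (f N) <= d)%N].

Definition h (k : nat) : family :=
  fun N => \sum_(m : 'X_{1..N < k.+1} | mdeg m == k) 'X_[m].

Definition hpart (la : seq nat) : family := fun N => \prod_(i <- la) h i N.

(* The sum of all monomials whose nonzero exponents are the parts of la. *)
Definition mpart (la : seq nat) : family :=
  fun N => \sum_(m : 'X_{1..N < (sumn la).+1}
                 | perm_eq [seq a <- (m : 'X_{1..N}) | (0 < a)%N] la) 'X_[m].

(* p_n o f = f(x_0^n, x_1^n, ...) *)
Definition plethysm_p (n : nat) (f : family) : family :=
  fun N => f N \mPo [tuple 'X_i ^+ n | i < N].

Definition lincomb (c : rat) (f g : family) : family := fun N => c *: f N + g N.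

End SymFun.

(* Partitions are weakly decreasing sequences of positive integers. *)
Definition is_partition (d : nat) (la : seq nat) : bool :=
  [&& sorted geq la, 0%N \notin la & sumn la == d].

(* The rational bilinear forms on the symmetric functions for which the h_la
   and the m_mu are dual bases: as both are bases, the restriction of sp to
   symmetric functions is determined by this. Values of sp on families that
   are not symmetric functions are irrelevant.                                *)
Definition standard_scalar_product
    (sp : SymFun.family -> SymFun.family -> rat) : Prop :=
  [/\ forall c f g u, SymFun.symfun f -> SymFun.symfun g -> SymFun.symfun u ->
        sp (SymFun.lincomb c f g) u = c * sp f u + sp g u,
      forall c f g u, SymFun.symfun f -> SymFun.symfun g -> SymFun.symfun u ->
        sp u (SymFun.lincomb c f g) = c * sp u f + sp u g
    & forall d e la mu, is_partition d la -> is_partition e mu ->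
        sp (SymFun.hpart la) (SymFun.mpart mu) = (la == mu)%:R].

(* Bernoulli numbers (those of t / (e^t - 1)), through the recurrence
   \sum_(j <= m) 'C(m.+1, j) B_j = (m == 0).                                  *)
Fixpoint bernoulli_seq (m : nat) : seq rat :=
  if m is m'.+1 then
    let s := bernoulli_seq m' in
    rcons s (((m' == 0)%:R - \sum_(j < m') 'C(m'.+1, j)%:R * s`_j) / m'.+1%:R)
  else [::].

Definition bernoulli (m : nat) : rat := (bernoulli_seq m.+1)`_m.

Lemma size_bernoulli_seq m : size (bernoulli_seq m) = m.
Proof. by elim: m => //= m IHm; rewrite size_rcons IHm. Qed.

Lemma nth_bernoulli_seq m j : (j < m)%N -> (bernoulli_seq m)`_j = bernoulli j.
Proof.
elim: m => // m IHm; rewrite ltnS leq_eqVlt => /predU1P[-> //|ltjm].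
by rewrite /= nth_rcons size_bernoulli_seq ltjm IHm.
Qed.

Lemma bernoulli_rec m :
  \sum_(j < m.+1) 'C(m.+1, j)%:R * bernoulli j = (m == 0)%:R.
Proof.
rewrite big_ord_recr /= binSn {2}/bernoulli /= nth_rcons size_bernoulli_seq.
rewrite ltnn eqxx (mulrC m.+1%:R) divfK ?pnatr_eq0 // addrC.
rewrite [X in _ + X](eq_bigr (fun j : 'I_m =>
  'C(m.+1, j)%:R * (bernoulli_seq m)`_j)) ?subrK // => j _.
by rewrite nth_bernoulli_seq.
Qed.

Definition scale_part (q : nat) (la : seq nat) : seq nat := map (muln q) la.
Definition bernoulli_part (la : seq nat) : rat := \prod_(i <- la) bernoulli i.
Definition fact_part (la : seq nat) : nat := (\prod_(i <- la) i`!)%N.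
(* nu x = 2^(x-1) - 1, only meaningful (and used) for x > 0. *)
Definition nu (x : nat) : rat := 2 ^+ x.-1 - 1.
Definition nu_part (la : seq nat) : rat := \prod_(i <- la) nu i.
Definition zee (mu : seq nat) : nat :=
  (\prod_(1 <= i < (sumn mu).+1) (i ^ count_mem i mu * (count_mem i mu)`!))%N.

From mathcomp Require Import all_classical all_reals all_analysis.
From mathcomp Require Import complex.
Import numFieldNormedType.Exports.
Local Open Scope classical_set_scope.

Definition eps (i j : nat) : nat := if (i == j) && odd i then 0%N else 1%N.

Definition eps_seq (s : seq nat) : nat :=
  (\prod_(j < (size s).-1) eps (nth 0%N s j) (nth 0%N s j.+1))%N.

Definition pamzv_term (R : realType) (n : nat) (s : seq nat) : R :=
  (eps_seq s)%:R * ((-1) ^+ sumn s / \prod_(i <- s) i%:R ^+ n).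

(* The truncation of the series S_k(n) to 1 <= i_1 <= ... <= i_k <= N. *)
Definition pamzv_partial (R : realType) (k n : nat) : R ^nat := fun N =>
  \sum_(t : k.-tuple 'I_N.+1 | path leq 1 [seq val i | i <- t])
    pamzv_term R n [seq val i | i <- t].

Definition pamzv (R : realType) (k n : nat) : R := limn (pamzv_partial R k n).

(* Main.v *)
Require Import Defs.
From mathcomp Require Import all_boot all_order all_algebra.
From mathcomp Require Import perm all_field.
From mathcomp Require Import ring lra zify.
From mathcomp Require boolp mpoly.

Set Implicit Arguments.
Unset Strict Implicit.
Unset Printing Implicit Defensive.

Import Order.TTheory GRing.Theory Num.Theory.
Local Open Scope ring_scope.

(** Write b_m = B_(2m) / (2m)! and G(u) = \sum_m b_m u^m.

Let a_k(N) be the sum over 1 <= i_1 <= ... <= i_k <= N that defines the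
truncation of S_k(2n). As odd indices carry a sign and are never repeated,
while even indices may be, the generating series \sum_k a_k(N) t^k is the
product of the factors 1 - t / i^(2n) for i <= N odd and
(1 - t / i^(2n))^-1 for i <= N even. Its logarithmic derivative t d/dt log is
the series with coefficients \sum_(i <= N) (-1)^i / i^(2nr), for r >= 1.

By Euler's evaluation of the zeta values these coefficients tend to
(-pi^2)^(nr) q_(nr), where q_m = (2^(2m-1) - 1) b_m
([cvg_alternating_zeta]). A series with constant term 1 is determined by its
logarithmic derivative through Newton's identities
k a_k = \sum_(1 <= r <= k) p_r a_(k-r), which is the relation [newton a p]
around which the proof is organised; hence a_k(N) tends to (-pi^2)^(nk) f_k,
where F(t) = \sum_k f_k t^k has the logarithmic derivative
\sum_r q_(nr) t^r. The three formulas are three evaluations of f_k.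

- F = exp(\sum_r q_(nr) t^r / r), whose expansion is the sum over partitions
  with weights 1 / z_mu ([newton_cycle_index]).
- The logarithmic derivative of G is \sum_r q_r u^r ([newton_bnum]), so that of
  \prod_(1 <= j <= n) G(omega^j u) keeps only the exponents divisible by n and
  the product is F(u^n) ([root_of_unity_product]).
- The same lemma, applied to the complete symmetric functions h_k and the power
  sums p_r instead of b_k and q_r, writes p_n o h_k as the sum of the products
  omega^(m_1 + 2 m_2 + ... + n m_n) h_(m_1) ... h_(m_n). The coefficients lie in
  a number field K; a Q-linear retraction of K onto Q turns this into a rational
  expansion in the h_lambda with l(lambda) <= n, whose coefficients are the
  scalar products with the m_lambda. Replacing h_m by b_m recovers f_k
  ([scalar_product_formula]).

Euler's evaluation follows Cauchy. For N = 2M + 1 the numbers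
tan^2 (j pi / N), 1 <= j <= M, are the roots of a polynomial read off from the
expansion of sin (N x). Newton's identities then give the limits of the power
sums of the cot^2 (j pi / N) / N^2, and cot^2 x <= 1 / x^2 <= 1 + cot^2 x
compares them with \sum_j (j pi)^(-2r). *)

(** * Newton's identities as logarithmic derivatives *)

(** Newton's identities m a_m = \sum_(1 <= r <= m) p_r a_(m-r): the series
\sum_m a_m u^m has the logarithmic derivative (with respect to u d/du)
\sum_(r >= 1) p_r u^r. The value of p at 0 is irrelevant. *)
Definition newton (A : comNzRingType) (a p : nat -> A) : Prop :=
  forall m, a m *+ m = \sum_(r < m) p r.+1 * a (m - r.+1)%N.

(** The additive group has no torsion, so that Newton's identities determine a
from p and a_0. *)
Definition torsion_free (A : nzRingType) : Prop :=
  forall m (x : A), (0 < m)%N -> x *+ m = 0 -> x = 0.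

(** P is the logarithmic derivative of H up to degree d; polynomials stand for
power series modulo 'X^(d+1). *)
Definition dlog (A : comNzRingType) (d : nat) (H P : {poly A}) : Prop :=
  forall m, (m <= d)%N -> ('X * H^`())`_m = (P * H)`_m.

Section Dlog.
Variable A : comNzRingType.
Implicit Types (H P Q : {poly A}) (a p : nat -> A) (d m : nat).

Lemma coef_theta H m : ('X * H^`())`_m = H`_m *+ m.
Proof. by rewrite coefXM coef_deriv; case: m. Qed.

Lemma eq_coefM d H1 H2 Q : (forall m, (m <= d)%N -> H1`_m = H2`_m) ->
  forall m, (m <= d)%N -> (H1 * Q)`_m = (H2 * Q)`_m.
Proof.
move=> eqH m lemd; rewrite !coefM; apply: eq_bigr => i _.
by rewrite eqH // (leq_trans _ lemd) // -ltnS.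
Qed.

Lemma dlog_mul d H1 P1 H2 P2 :
  dlog d H1 P1 -> dlog d H2 P2 -> dlog d (H1 * H2) (P1 + P2).
Proof.
move=> D1 D2 m lemd; rewrite derivM mulrDr mulrA mulrCA mulrDl !coefD.
rewrite (eq_coefM _ D1) // -!mulrA [H1 * (_ * _)]mulrC.
by rewrite (eq_coefM _ D2) // -mulrA [H2 * H1]mulrC.
Qed.

Lemma dlog1 d : @dlog A d 1 0.
Proof. by move=> m _; rewrite derivE mulr0 mul0r. Qed.

Lemma dlog_prod d (I : Type) (s : seq I) (H P : I -> {poly A}) :
  (forall i, dlog d (H i) (P i)) ->
  dlog d (\prod_(i <- s) H i) (\sum_(i <- s) P i).
Proof.
move=> D; elim: s => [|i s IHs]; first by rewrite !big_nil; apply: dlog1.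
by rewrite !big_cons; apply: dlog_mul.
Qed.

Lemma coefM_eq0 d H Q : H`_0 = 1 ->
  (forall m, (m <= d)%N -> (H * Q)`_m = 0) ->
  forall m, (m <= d)%N -> Q`_m = 0.
Proof.
move=> H0 HQ m; elim/ltn_ind: m => m IHm lemd.
have := HQ m lemd; rewrite coefM big_ord_recl subn0 H0 mul1r big1 ?addr0 // => i _.
have lt_i := ltn_ord i.
by rewrite lift0 IHm ?mulr0 //; lia.
Qed.

Lemma dlog_div d H1 P1 H2 P2 : H1`_0 = 1 ->
  dlog d H1 P1 -> dlog d (H1 * H2) (P1 + P2) -> dlog d H2 P2.
Proof.
move=> H0 D1 D m lemd; apply/eqP; rewrite -subr_eq0 -coefB; apply/eqP.
apply: (coefM_eq0 (H := H1) (d := d)) => // {}m {}lemd.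
have := D m lemd; rewrite derivM mulrDr mulrA mulrDl !coefD.
rewrite (eq_coefM _ D1) // => /eqP; rewrite -mulrA (inj_eq (addrI _)) => /eqP e.
by rewrite mulrBr coefB mulrCA e mulrCA subrr.
Qed.

Lemma eq_dlog d H P H' P' :
  (forall m, (m <= d)%N -> H`_m = H'`_m) ->
  (forall m, (m <= d)%N -> P`_m = P'`_m) -> dlog d H P -> dlog d H' P'.
Proof.
move=> eqH eqP D m lemd; rewrite coef_theta -eqH // -coef_theta D //.
by rewrite (eq_coefM _ eqP) // ![P' * _]mulrC (eq_coefM _ eqH).
Qed.

(** The truncation to degree d of a power series with coefficients a. *)
Definition tpoly d a : {poly A} := \poly_(i < d.+1) a i.
(** The truncation without its constant term, because [newton] ignores p_0
whereas [dlog] does not. *)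
Definition tpoly0 d p : {poly A} := \poly_(i < d.+1) (if i == 0 then 0 else p i).

Lemma coef_tpoly d a m : (m <= d)%N -> (tpoly d a)`_m = a m.
Proof. by move=> le; rewrite coef_poly ltnS le. Qed.

Lemma coef_tpoly0 d p m : (m <= d)%N ->
  (tpoly0 d p)`_m = if m == 0%N then 0 else p m.
Proof. by move=> le; rewrite coef_poly ltnS le. Qed.

Lemma newton_dlog a p : newton a p <-> forall d, dlog d (tpoly d a) (tpoly0 d p).
Proof.
have E d m : (m <= d)%N -> ((tpoly0 d p * tpoly d a)`_m =
    \sum_(r < m) p r.+1 * a (m - r.+1)%N).
  move=> lemd; rewrite coefM big_ord_recl coef_tpoly0 // mul0r add0r.
  apply: eq_bigr => i _; have lt_i := ltn_ord i.
  by rewrite lift0 coef_tpoly0 ?coef_tpoly //; lia.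
split=> [Na d m lemd | D m].
  by rewrite coef_theta E // coef_tpoly.
by have := D m m (leqnn _); rewrite coef_theta E // coef_tpoly.
Qed.

Lemma dlog_coef_uniq d H H' P : torsion_free A -> P`_0 = 0 -> H`_0 = H'`_0 ->
  dlog d H P -> dlog d H' P -> forall m, (m <= d)%N -> H`_m = H'`_m.
Proof.
move=> tfA P0 H0 D D' m; elim/ltn_ind: m => -[//|m] IHm lemd.
apply/eqP; rewrite -subr_eq0; apply/eqP/(tfA m.+1) => //.
rewrite mulrnBl -!coef_theta D // D' // !coefM -sumrB big1 // => i _.
case: (posnP i) => [->|i_gt0]; first by rewrite P0 !mul0r subrr.
by rewrite IHm ?subrr //; have := ltn_ord i; lia.
Qed.

Lemma eq_newton a a' p p' : a =1 a' -> (forall r, (0 < r)%N -> p r = p' r) ->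
  newton a p -> newton a' p'.
Proof.
move=> ea ep Na m; rewrite -ea Na; apply: eq_bigr => i _.
by rewrite ep // ea.
Qed.

Lemma newton_scale a p c : newton a p ->
  newton (fun m => c ^+ m * a m) (fun r => c ^+ r * p r).
Proof.
move=> Na m; rewrite -mulrnAr Na mulr_sumr; apply: eq_bigr => i _.
rewrite mulrACA -exprD; congr (_ ^+ _ * _); have := ltn_ord i; lia.
Qed.

(** The coefficients of a product of power series, as a sum over exponents. *)
Lemma coef_prod_tpoly n d (c : 'I_n -> nat -> A) :
  (\prod_(i < n) tpoly d (c i))`_d =
  \sum_(m : {ffun 'I_n -> 'I_d.+1} | (\sum_i m i)%N == d) \prod_(i < n) c i (m i).
Proof.
under eq_bigr do rewrite /tpoly poly_def.
rewrite bigA_distr_bigA coef_sum [RHS]big_mkcond; apply: eq_bigr => m _.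
rewrite scaler_prod coefZ prodrXr coefXn eq_sym.
by case: eqP; rewrite ?mulr1 ?mulr0.
Qed.

(** The logarithmic derivative of 1 / (1 - c u) is \sum_(r >= 1) c^r u^r. *)
Lemma newton_geometric (c : A) : newton (fun m => c ^+ m) (fun r => c ^+ r).
Proof.
move=> m; rewrite -[X in _ *+ X](card_ord m) -sumr_const.
by apply: eq_bigr => i _; rewrite -exprD subnKC.
Qed.

End Dlog.

Lemma newton_map (A B : comNzRingType) (f : {rmorphism A -> B}) (a p : nat -> A) :
  newton a p -> newton (fun m => f (a m)) (fun r => f (p r)).
Proof.
by move=> Na m; rewrite -rmorphMn Na rmorph_sum; apply: eq_bigr => i _; rewrite rmorphM.
Qed.

Lemma eq_coef_prod (A : comNzRingType) d (I : Type) (s : seq I) (H H' : I -> {poly A}) :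
  (forall i m, (m <= d)%N -> (H i)`_m = (H' i)`_m) ->
  forall m, (m <= d)%N -> (\prod_(i <- s) H i)`_m = (\prod_(i <- s) H' i)`_m.
Proof.
move=> eqH; elim/big_rec2: _ => // i x y _ IH m lem.
by rewrite (eq_coefM _ (eqH i)) // ![H' i * _]mulrC (eq_coefM _ IH).
Qed.

Lemma newton_mul (A : comNzRingType) (a b c p q : nat -> A) :
  (forall m, c m = \sum_(i < m.+1) a i * b (m - i)%N) ->
  newton a p -> newton b q -> newton c (fun i => p i + q i).
Proof.
move=> cE /newton_dlog Da /newton_dlog Db; apply/newton_dlog => d.
apply: eq_dlog (dlog_mul (Da d) (Db d)) => m lem; last first.
  by rewrite coefD !coef_tpoly0 //; case: eqP; rewrite ?addr0.
rewrite coef_tpoly // cE coefM; apply: eq_bigr => i _.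
by rewrite !coef_tpoly //; have := ltn_ord i; lia.
Qed.

Lemma newton_div (A : comNzRingType) (a b c p r : nat -> A) :
  a 0%N = 1 -> (forall m, c m = \sum_(i < m.+1) a i * b (m - i)%N) ->
  newton a p -> newton c r -> newton b (fun i => r i - p i).
Proof.
move=> a0 cE /newton_dlog Da /newton_dlog Dc; apply/newton_dlog => d.
refine (dlog_div (H1 := tpoly d a) (P1 := tpoly0 d p) _ (Da d) _).
  by rewrite coef_tpoly.
apply: eq_dlog (Dc d) => m lem; last first.
  by rewrite coefD !coef_tpoly0 //; case: eqP; rewrite ?addr0 // addrC subrK.
rewrite coef_tpoly // cE coefM; apply: eq_bigr => i _.
by rewrite !coef_tpoly //; have := ltn_ord i; lia.
Qed.

(** The recurrence says that c = b / (1 - x u) as power series. *)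
Lemma geometric_conv (A : comNzRingType) (x : A) (b c : nat -> A) :
  c 0%N = b 0%N -> (forall k, c k.+1 = b k.+1 + x * c k) ->
  forall m, c m = \sum_(i < m.+1) x ^+ i * b (m - i)%N.
Proof.
move=> c0 cS; elim=> [|m IHm]; first by rewrite big_ord1 mul1r.
rewrite cS IHm [RHS]big_ord_recl mul1r subn0 mulr_sumr; congr (_ + _).
by apply: eq_bigr => i _; rewrite lift0 exprS mulrA.
Qed.

Lemma torsion_free_num (F : numDomainType) : torsion_free F.
Proof. by move=> [//|m] x _ /eqP; rewrite mulrn_eq0 /= => /eqP. Qed.

Lemma sum_unity_powers (F : idomainType) n (w : F) r : n.-primitive_root w ->
  \sum_(j < n) w ^+ (j.+1 * r) = if (n %| r)%N then n%:R else 0.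
Proof.
move=> pw; case: ifP => [/dvdnP[q ->]|nr].
  rewrite (eq_bigr (fun=> 1)) ?sumr_const ?card_ord // => j _.
  by rewrite mulnA exprM -exprM mulnC exprM (prim_expr_order pw) expr1n.
have w1 : w ^+ r - 1 != 0.
  by rewrite subr_eq0 -(prim_order_dvd pw) nr.
apply: (mulfI w1); rewrite mulr0.
transitivity (w ^+ r * ((w ^+ r - 1) * \sum_(j < n) (w ^+ r) ^+ j)).
  rewrite mulrCA; congr (_ * _); rewrite mulr_sumr; apply: eq_bigr => j _.
  by rewrite -exprS -exprM mulnC.
by rewrite -subrX1 -exprM mulnC exprM (prim_expr_order pw) expr1n subrr mulr0.
Qed.

(** If A(u) has the logarithmic derivative \sum_r p_r u^r and F(t) has
\sum_r p_(nr) t^r, then \prod_(1 <= j <= n) A(w^j u) = F(u^n). Only the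
orthogonality relations of the powers of w are used, so that w may be the image
of a root of unity in a ring that is not a domain. The index j of the product
is shifted by one in the statement. *)
Theorem root_of_unity_product (A : comNzRingType) (n : nat) (w : A)
    (a p f : nat -> A) (k : nat) :
  torsion_free A -> (0 < n)%N ->
  (forall r, \sum_(j < n) w ^+ (j.+1 * r) = if (n %| r)%N then n%:R else 0) ->
  newton a p -> a 0%N = 1 -> newton f (fun r => p (n * r)%N) -> f 0%N = 1 ->
  \sum_(m : {ffun 'I_n -> 'I_(n * k).+1} | (\sum_i m i)%N == (n * k)%N)
     w ^+ (\sum_(i < n) i.+1 * m i)%N * \prod_(i < n) a (m i) = f k.
Proof.
move=> tfA n_gt0 wn Na a0 Nf f0; set d := (n * k)%N.
pose c (j : 'I_n) m := w ^+ (j.+1 * m) * a m.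
under eq_bigr do rewrite -prodrXr -big_split /=.
rewrite -(coef_prod_tpoly d c); pose F := tpoly k f \Po 'X^n.
have coefF m : F`_m = if (n %| m)%N then (tpoly k f)`_(m %/ n) else 0.
  by rewrite coef_comp_poly_Xn.
have lek m : (m <= d)%N -> (m %/ n <= k)%N.
  by rewrite /d => lemd; rewrite -(mulKn k n_gt0) leq_div2r.
have -> : f k = F`_d.
  by rewrite coefF dvdn_mulr // mulKn // coef_tpoly.
(* Both sides have the logarithmic derivative n \sum_r p_(nr) u^(nr). *)
pose P := (tpoly0 k (fun r => p (n * r)%N) \Po 'X^n) *+ n.
apply: (dlog_coef_uniq (d := d) (P := P)) => //.
- by rewrite /P coefMn coef_comp_poly_Xn // dvdn0 div0n coef_tpoly0 //= mul0rn.
- rewrite coefF dvdn0 div0n coef_tpoly // f0 -horner_coef0 horner_prod big1 // => i _.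
  by rewrite horner_coef0 coef_tpoly // /c muln0 mul1r.
- have D (j : 'I_n) : dlog d (tpoly d (c j)) (tpoly0 d (fun r => w ^+ (j.+1 * r) * p r)).
    have /newton_dlog := newton_scale (w ^+ j.+1) Na => /(_ d).
    by apply: eq_dlog => m lem; rewrite ?coef_tpoly ?coef_tpoly0 // /c ?exprM.
  apply: eq_dlog (dlog_prod _ D) => // m lem.
  rewrite /P coef_sum coefMn coef_comp_poly_Xn //.
  under eq_bigr do rewrite coef_tpoly0 //.
  have [->|m_gt0] := posnP m.
    by rewrite sumr_const mul0rn dvdn0 div0n coef_tpoly0 //= mul0rn.
  rewrite -mulr_suml wn; case: ifP => [nm|_]; last by rewrite mul0r mul0rn.
  rewrite coef_tpoly0 ?lek // mulr_natl -{1}(divnK nm) mulnC.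
  by case: eqP => // e; move: m_gt0; rewrite -(divnK nm) e.
move=> m lem.
have -> : 'X * F^`() = (('X * (tpoly k f)^`()) \Po 'X^n) *+ n.
  rewrite deriv_comp derivXn comp_polyM comp_polyX mulrnAr mulrnAr; congr (_ *+ _).
  by rewrite mulrCA -exprS prednK // mulrC.
rewrite /P mulrnAl !coefMn -comp_polyM !coef_comp_poly_Xn //; case: ifP => // nm.
by have /newton_dlog -> := Nf; rewrite ?lek.
Qed.

(** * Bernoulli numbers *)

Lemma big_ord_double (V : nmodType) n (F : nat -> V) :
  \sum_(j < n.*2) F j = \sum_(r < n) (F r.*2 + F r.*2.+1).
Proof.
elim: n => [|n IHn]; first by rewrite !big_ord0.
by rewrite doubleS !big_ord_recr /= IHn addrA.
Qed.

Lemma odd_exp_N1 m : (-1 : rat) ^+ m = if odd m then -1 else 1.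
Proof. by rewrite -signr_odd; case: odd; rewrite ?expr1. Qed.

(** exp(c t), truncated to degree d. *)
Definition trunc_exp (d : nat) (c : rat) : {poly rat} :=
  tpoly d (fun i => c ^+ i / i`!%:R).

Lemma bin_over_fact (m i : nat) : (i <= m)%N ->
  'C(m, i)%:R / m`!%:R = (i`!%:R)^-1 * ((m - i)`!%:R)^-1 :> rat.
Proof.
move=> lei; have /(congr1 (fun x => x%:R : rat)) := bin_fact lei.
rewrite !natrM => <-.
have F j : j`!%:R != 0 :> rat by rewrite pnatr_eq0 -lt0n fact_gt0.
have : 'C(m, i)%:R != 0 :> rat by rewrite pnatr_eq0 -lt0n bin_gt0.
by move=> ?; field; rewrite !F.
Qed.

Lemma coef_trunc_expM d a b m : (m <= d)%N ->
  (trunc_exp d a * trunc_exp d b)`_m = (a + b) ^+ m / m`!%:R.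
Proof.
move=> lemd; rewrite coefMr exprDn mulr_suml; apply: eq_bigr => i _.
have lei : (i <= m)%N by rewrite -ltnS.
rewrite !coef_tpoly ?(leq_trans _ lemd) ?leq_subr //.
rewrite -[in RHS]mulr_natr -[in RHS](mulrA _ _ (_^-1)) bin_over_fact //; ring.
Qed.

(** The numbers B_(2r) / (2r)!, coefficients of (y/2) coth(y/2) in u = y^2. *)
Definition bnum (r : nat) : rat := bernoulli (2 * r) / (2 * r)`!%:R.
(** The coefficients of sinh y / y in u = y^2. *)
Definition sinhc (k : nat) : rat := (k.*2.+1`!%:R)^-1.
(** The coefficients of cosh y in u = y^2. *)
Definition coshc (k : nat) : rat := (k.*2`!%:R)^-1.

(** \sum_j B_j (2t)^j / j! is 2t / (e^(2t) - 1). *)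
Lemma coef_exp_bernoulli d m : (m <= d)%N ->
  (tpoly d (fun j => 2 ^+ j * bernoulli j / j`!%:R) * (trunc_exp d 2 - 1))`_m
  = (2 *: 'X)`_m :> rat.
Proof.
move=> lemd; rewrite coefM coefZ coefX big_ord_recr /= subnn coefB coefC eqxx.
rewrite [(trunc_exp _ _)`__]coef_tpoly // expr0 fact0 divr1 subrr mulr0 addr0.
case: m lemd => [|m] lemd; first by rewrite big_ord0 mulr0.
rewrite eqSS.
transitivity (2 ^+ m.+1 / m.+1`!%:R * \sum_(j < m.+1) 'C(m.+1, j)%:R * bernoulli j).
  rewrite mulr_sumr; apply: eq_bigr => i _; have lti := ltn_ord i.
  rewrite coefB coefC; have -> : (m.+1 - i == 0)%N = false by lia.
  rewrite !coef_tpoly ?subr0; try lia.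
  rewrite [RHS](_ : _ = 2 ^+ m.+1 * ('C(m.+1, i)%:R / m.+1`!%:R) * bernoulli i);
    last by ring.
  rewrite bin_over_fact ?(ltnW lti) //.
  have -> : 2 ^+ m.+1 = 2 ^+ i * 2 ^+ (m.+1 - i) :> rat.
    by rewrite -exprD subnKC // ltnW.
  by ring.
rewrite bernoulli_rec.
by case: eqP => [->|_]; rewrite ?mulr0 // expr1 divr1.
Qed.

(** (y coth y) (sinh y / y) = cosh y, obtained from the coefficient of y^(2m+1) in
(2y / (e^(2y) - 1) + y) (e^y - e^-y) = y (e^y + e^-y). Since e^y - e^-y is odd,
only Bernoulli numbers of even index contribute to it. *)
Lemma coth_mul_sinh m :
  \sum_(r < m.+1) 4 ^+ r * bnum r * sinhc (m - r) = coshc m.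
Proof.
pose d := m.*2.+1.
pose be := tpoly d (fun j => 2 ^+ j * bernoulli j / j`!%:R).
pose W := be + 'X; pose D := trunc_exp d 1 - trunc_exp d (-1).
have e1 i : (i <= d)%N -> D`_i = (trunc_exp d (-1) * (trunc_exp d 2 - 1))`_i.
  move=> lei; rewrite mulrBr mulr1 !coefB coef_trunc_expM //.
  by rewrite (_ : -1 + 2 = 1) // coef_tpoly.
have e2 i : (i <= d)%N -> (be * (trunc_exp d 2 - 1))`_i = (2 *: 'X)`_i.
  exact: coef_exp_bernoulli.
have e3 : (W * D)`_d = ('X * (trunc_exp d 1 + trunc_exp d (-1)))`_d.
  rewrite mulrC (eq_coefM _ e1) //.
  rewrite (_ : _ * W = be * (trunc_exp d 2 - 1) * trunc_exp d (-1) +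
    'X * (trunc_exp d (-1) * trunc_exp d 2) - 'X * trunc_exp d (-1)); last first.
    by rewrite /W; ring.
  rewrite coefB coefD (eq_coefM _ e2) // -scalerAl coefZ !coefXM /= coefD.
  rewrite coef_trunc_expM ?(leqW (leqnn _)) // (_ : -1 + 2 = 1) //.
  by rewrite [(trunc_exp d 1)`__]coef_tpoly ?(leqW (leqnn _)) //; ring.
have W1 r : (r <= m)%N -> W`_r.*2 = 4 ^+ r * bnum r.
  move=> ler; rewrite coefD coefX coef_tpoly; last by rewrite /d; lia.
  rewrite (_ : (r.*2 == 1%N) = false) ?addr0 /bnum ?mul2n; last by lia.
  by rewrite -mul2n exprM -mulrA.
have D1 r : (r <= m)%N -> D`_(d - r.*2) = 2 * sinhc (m - r).
  move=> ler; rewrite (_ : (d - r.*2 = (m - r).*2.+1)%N); last by rewrite /d; lia.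
  rewrite coefB !coef_tpoly ?expr1n ?odd_exp_N1 ?oddS ?odd_double /sinhc /=; try by rewrite /d; lia.
  by ring.
have D0 r : (r <= m)%N -> D`_(d - r.*2.+1) = 0.
  move=> ler; rewrite (_ : (d - r.*2.+1 = (m - r).*2)%N); last by rewrite /d; lia.
  rewrite coefB !coef_tpoly ?expr1n ?odd_exp_N1 ?odd_double; try by rewrite /d; lia.
  by rewrite subrr.
move: e3; rewrite coefXM /= coefD !coef_tpoly ?leqnSn //= coefM.
rewrite (big_ord_double m.+1 (fun j => W`_j * D`_(d - j))).
rewrite odd_exp_N1 odd_double expr1n -/(coshc m) => e3.
apply: (@mulfI _ 2) => //; rewrite mulr_sumr.
transitivity (coshc m + coshc m); last by ring.
rewrite -[coshc m]mul1r -e3; apply: eq_bigr => r _.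
have ler : (r <= m)%N by rewrite -ltnS.
by rewrite D0 // D1 // W1 //; ring.
Qed.

(** The derivative of sinh is cosh. *)
Lemma sinhc_coshc m : coshc m = m.*2.+1%:R * sinhc m.
Proof.
rewrite /coshc /sinhc factS natrM invfM mulrA divff ?mul1r //.
by rewrite pnatr_eq0.
Qed.

(** sinh(2y) = 2 sinh y cosh y, divided by 2y. *)
Lemma sinh_double m :
  4 ^+ m * sinhc m = \sum_(r < m.+1) sinhc r * coshc (m - r).
Proof.
pose d := m.*2.+1.
pose D := trunc_exp d 1 - trunc_exp d (-1).
pose C := trunc_exp d 1 + trunc_exp d (-1).
have e : (D * C)`_d = (2 ^+ d / d`!%:R) - ((-2) ^+ d / d`!%:R).
  rewrite (_ : D * C = trunc_exp d 1 * trunc_exp d 1 -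
    trunc_exp d (-1) * trunc_exp d (-1)); last by rewrite /D /C; ring.
  by rewrite coefB !coef_trunc_expM.
move: e; rewrite coefM (big_ord_double m.+1 (fun j => D`_j * C`_(d - j))).
rewrite exprNn odd_exp_N1 oddS odd_double /= => e.
apply: (@mulfI _ 4) => //; rewrite mulr_sumr.
transitivity (2 ^+ d / d`!%:R - -1 * 2 ^+ d / d`!%:R : rat).
  by rewrite /d exprS -mul2n exprM /sinhc mul2n -[2 ^+ 2]/(4 : rat); ring.
rewrite -e; apply: eq_bigr => r _.
have ler : (r <= m)%N by rewrite -ltnS.
rewrite !coefB !coefD !coef_tpoly; try by rewrite /d; lia.
rewrite !odd_exp_N1 oddS !odd_double /= !expr1n.
rewrite (_ : (d - r.*2.+1 = (m - r).*2)%N) ?odd_double; last by rewrite /d; lia.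
rewrite (_ : odd (d - r.*2) = true); last by rewrite /d; lia.
by rewrite /sinhc /coshc; ring.
Qed.

Lemma sinhc0 : sinhc 0 = 1. Proof. by []. Qed.

Lemma bnum0 : bnum 0 = 1.
Proof.
by rewrite /bnum divr1 -[RHS](bernoulli_rec 0) big_ord1 bin0 mul1r.
Qed.

Lemma newton_sinhc : newton sinhc (fun r => 4 ^+ r * bnum r / 2).
Proof.
move=> m; have := coth_mul_sinh m.
rewrite big_ord_recl subn0 sinhc_coshc expr0 mul1r bnum0 mul1r => e.
have -> : sinhc m *+ m = (m.*2.+1%:R * sinhc m - sinhc m) / 2.
  by rewrite -mulr_natr -addn1 natrD -muln2 natrM; field.
rewrite -e addrC addKr mulr_suml; apply: eq_bigr => r _.
by rewrite lift0; ring.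
Qed.

(** From cosh y = (sinh(2y) / 2y) / (sinh y / y). *)
Lemma newton_coshc : newton coshc (fun r => (16 ^+ r - 4 ^+ r) * bnum r / 2).
Proof.
have := newton_div sinhc0 sinh_double newton_sinhc (newton_scale 4 newton_sinhc).
apply: eq_newton => // r _.
have -> : 16 = 4 * 4 :> rat by [].
by rewrite exprMn; ring.
Qed.

(** The logarithmic derivative of G(u) = \sum_r b_r u^r: as G(4u) is cosh y
divided by sinh y / y, it is found from those of the two factors. *)
Lemma newton_bnum : newton bnum (fun r => nu (2 * r) * bnum r).
Proof.
have cE m : coshc m = \sum_(r < m.+1) sinhc r * (4 ^+ (m - r) * bnum (m - r)).
  rewrite -coth_mul_sinh (reindex_inj rev_ord_inj); apply: eq_bigr => r _ /=.
  have ler : (r <= m)%N by rewrite -ltnS.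
  by rewrite subSS (subKn ler); apply: mulrC.
have := newton_div (b := fun r => 4 ^+ r * bnum r) sinhc0 cE newton_sinhc newton_coshc.
move/(newton_scale (4^-1)).
apply: eq_newton => [m | [//|r] _].
  by rewrite mulrA -exprMn mulVf // expr1n mul1r.
rewrite /nu (_ : (2 * r.+1).-1 = (2 * r).+1)%N; last by lia.
rewrite [2 ^+ _.+1]exprS [2 ^+ (2 * r)]exprM -[2 ^+ 2]/(4 : rat).
have -> : 16 = 4 * 4 :> rat by [].
by rewrite exprMn exprVn [4 ^+ r.+1]exprS; field; rewrite expf_neq0.
Qed.

(** * Partitions and the cycle index *)

Lemma geq_trans : transitive geq.
Proof. by move=> a b c; rewrite /geq /= => h1 h2; apply: leq_trans h2 h1. Qed.

Lemma geq_anti : antisymmetric geq.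
Proof. by move=> a b; rewrite /geq /= => /andP[h1 h2]; apply/eqP; rewrite eqn_leq h1 h2. Qed.

Lemma geq_total : total geq.
Proof. by move=> a b; rewrite /geq /= leq_total. Qed.

(** The partition formed by the nonzero terms of a sequence. *)
Definition partof (s : seq nat) : seq nat := sort geq [seq a <- s | (0 < a)%N].

Lemma perm_partof s : perm_eq (partof s) [seq a <- s | (0 < a)%N].
Proof. exact: permEl (perm_sort _ _). Qed.

Lemma sumn_partof s : sumn (partof s) = sumn s.
Proof.
rewrite (perm_sumn (perm_partof s)); elim: s => //= a s IHs.
by case: a => [|a] //=; rewrite IHs.
Qed.

Lemma partof_partition s : is_partition (sumn s) (partof s).
Proof.
rewrite /is_partition sumn_partof eqxx andbT (sort_sorted geq_total) /=.
by rewrite (perm_mem (perm_partof s)) mem_filter.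
Qed.

Lemma partition_gt0 d la a : is_partition d la -> a \in la -> (0 < a)%N.
Proof.
by case/and3P=> _ n0 _ ain; rewrite lt0n; apply: contraNneq n0 => <-.
Qed.

Lemma leq_mem_sumn (s : seq nat) a : a \in s -> (a <= sumn s)%N.
Proof. by move=> /perm_to_rem/perm_sumn->; rewrite /= leq_addr. Qed.

Lemma partition_le d la a : is_partition d la -> a \in la -> (a <= d)%N.
Proof. by case/and3P=> _ _ /eqP<-; apply: leq_mem_sumn. Qed.

Lemma partition_filter d la : is_partition d la -> [seq a <- la | (0 < a)%N] = la.
Proof. by move=> P; apply/all_filterP/allP => a; apply: partition_gt0 P. Qed.

Lemma partition_eq d e la mu : is_partition d la -> is_partition e mu ->
  perm_eq la mu -> la = mu.
Proof.
by case/and3P=> s1 _ _ /and3P[s2 _ _]; apply: sorted_eq s1 s2; [exact: geq_trans|exact: geq_anti].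
Qed.

Lemma partofE d s la : is_partition d la ->
  (partof s == la) = perm_eq [seq a <- s | (0 < a)%N] la.
Proof.
move=> P; apply/eqP/idP=> [<-|pe]; first by rewrite perm_sym perm_partof.
apply: (partition_eq (partof_partition s) P); exact: perm_trans (perm_partof s) pe.
Qed.

Lemma partition_size d la : is_partition d la -> (size la <= d)%N.
Proof.
move=> P; have /and3P[_ _ /eqP<-] := P.
have : all (leq 1) la by apply/allP=> a; apply: partition_gt0 P.
by elim: (la) => //= a s IHs /andP[a0 /IHs]; lia.
Qed.

(** The partition formed by the nonzero values of a finite family. *)
Definition ffun_part n d (m : {ffun 'I_n -> 'I_d.+1}) : seq nat :=
  partof [seq val (m i) | i <- enum 'I_n].

Lemma ffun_part_partition n d (m : {ffun 'I_n -> 'I_d.+1}) :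
  is_partition (\sum_i m i)%N (ffun_part m).
Proof.
have := partof_partition [seq val (m i) | i <- enum 'I_n].
by rewrite sumnE big_map big_enum.
Qed.

Lemma ffun_part_surj n d la : is_partition d la -> (size la <= n)%N ->
  exists m : {ffun 'I_n -> 'I_d.+1}, ffun_part m = la.
Proof.
move=> P sz; exists [ffun i : 'I_n => inord (nth 0%N la i)].
apply/eqP; rewrite (partofE _ P).
have -> : [seq val ([ffun i : 'I_n => inord (nth 0%N la i)] i : 'I_d.+1) | i <- enum 'I_n]
   = la ++ nseq (n - size la) 0%N.
  apply: (@eq_from_nth _ 0%N).
    by rewrite size_map size_enum_ord size_cat size_nseq subnKC.
  rewrite size_map size_enum_ord => i lti.
  rewrite (nth_map (Ordinal lti)) ?size_enum_ord // ffunE nth_cat nth_enum_ord //.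
  case: (ltnP i (size la)) => [lt|ge].
    by rewrite /= inordK // ltnS; apply: partition_le P _; apply: mem_nth.
  by rewrite /= nth_default // inordK // nth_nseq if_same.
rewrite filter_cat (partition_filter P) (_ : filter _ (nseq _ _) = [::]) ?cats0 //.
by elim: (n - _)%N.
Qed.

Lemma size_ffun_part n d (m : {ffun 'I_n -> 'I_d.+1}) : (size (ffun_part m) <= n)%N.
Proof.
rewrite (perm_size (perm_partof _)) size_filter (leq_trans (count_size _ _)) //.
by rewrite size_map size_enum_ord.
Qed.

(** The partitions of d, without repetition; a partition of d has at most d parts,
none of them larger than d. *)
Definition parts (d : nat) : seq (seq nat) :=
  undup [seq ffun_part m | m : {ffun 'I_d -> 'I_d.+1}
                          in [pred m : {ffun 'I_d -> 'I_d.+1} | (\sum_i m i == d)%N]].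

Lemma parts_uniq d : uniq (parts d). Proof. exact: undup_uniq. Qed.

Lemma mem_parts d la : (la \in parts d) = is_partition d la.
Proof.
rewrite mem_undup; apply/mapP/idP => [[m] | P].
  by rewrite mem_enum inE => /eqP sm ->; have := ffun_part_partition m; rewrite sm.
have [m mE] := ffun_part_surj P (partition_size P).
exists m; rewrite // mem_enum inE.
have /and3P[_ _ /eqP<-] := ffun_part_partition m.
by rewrite mE; have /and3P[] := P.
Qed.

Lemma big_ffun_part (R : Type) (idx : R) (op : Monoid.com_law idx) (F : nat -> R)
    n d (m : {ffun 'I_n -> 'I_d.+1}) :
  F 0%N = idx -> \big[op/idx]_(a <- ffun_part m) F a = \big[op/idx]_(i < n) F (m i).
Proof.
move=> F0; rewrite (perm_big _ (perm_partof _)) /= big_filter big_mkcond big_map.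
by rewrite big_enum /=; apply: eq_bigr => i _; rewrite lt0n; case: eqP => // ->.
Qed.

Section CycleIndex.
Variable p : nat -> rat.

(** \sum_(mu |- k) z_mu^-1 \prod_i p_(mu_i), the coefficient of u^k in
exp(\sum_(r >= 1) p_r u^r / r). *)
Definition cycle_index (k : nat) : rat :=
  \sum_(mu <- parts k) (\prod_(i <- mu) p i) / (zee mu)%:R.

(* The coefficients of exp(p_i u^i / i). *)
Let E (i m : nat) : rat :=
  if (i %| m)%N then (p i / i%:R) ^+ (m %/ i) / (m %/ i)`!%:R else 0.

Lemma newton_E i : (0 < i)%N -> newton (E i) (fun r => if r == i then p i else 0).
Proof.
move=> i_gt0 m; have iN0 : i%:R != 0 :> rat by rewrite pnatr_eq0 -lt0n.
have [lt|ge] := ltnP m i.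
  rewrite big1; last by move=> r _; case: eqP => [e|]; rewrite ?mul0r //; have := ltn_ord r; lia.
  rewrite /E; case: ifP => [/dvdnP[[|j] e]|]; rewrite ?mul0rn //; first by rewrite e mulr0n.
  by move: lt; rewrite e mulSn; lia.
have lt : (i.-1 < m)%N by lia.
rewrite (bigD1 (Ordinal lt)) //= prednK // eqxx big1 ?addr0 => [|r /eqP ne]; last first.
  case: eqP; rewrite ?mul0r // => e; case: ne; apply: val_inj => /=; lia.
rewrite /E dvdn_subl //; case: ifP => [/dvdnP[[|j] e]|]; rewrite ?mulr0 ?mul0rn //; first by lia.
rewrite e (_ : j.+1 * i - i = j * i)%N ?mulnK //; last by rewrite mulSn addKn.
rewrite exprS factS -[LHS]mulr_natr [(j.+1 * i)%:R]natrM [(j.+1 * j`!)%:R]natrM.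
have jN0 : j`!%:R != 0 :> rat by rewrite pnatr_eq0 -lt0n fact_gt0.
have jN1 : j%:R + 1 != 0 :> rat by rewrite natr1 pnatr_eq0.
by rewrite -[j.+1%:R]natr1; field; rewrite jN0 jN1 iN0.
Qed.

Lemma big_count_sum (F : nat -> nat) K (s : seq nat) :
  (forall a, a \in s -> 0 < a <= K)%N ->
  (\sum_(a <- s) F a = \sum_(i < K) F i.+1 * count_mem i.+1 s)%N.
Proof.
elim: s => [|a s IHs] sP; first by rewrite big_nil big1 // => i _; rewrite muln0.
rewrite big_cons IHs => [|b bs]; last by apply: sP; rewrite inE bs orbT.
under [RHS]eq_bigr do rewrite /= mulnDr.
rewrite big_split /=; congr addn.
have /andP[a0 aK] := sP a (mem_head _ _).
have lt : (a.-1 < K)%N by lia.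
rewrite (bigD1 (Ordinal lt)) //= prednK // eqxx muln1 big1 ?addn0 // => i /eqP ne.
by case: eqP => [e|]; rewrite ?muln0 //; case: ne; apply: val_inj => /=; lia.
Qed.

Lemma big_count_prod (A : comNzRingType) (F : nat -> A) K (s : seq nat) :
  (forall a, a \in s -> 0 < a <= K)%N ->
  \prod_(a <- s) F a = \prod_(i < K) F i.+1 ^+ count_mem i.+1 s.
Proof.
elim: s => [|a s IHs] sP; first by rewrite big_nil big1.
rewrite big_cons IHs => [|b bs]; last by apply: sP; rewrite inE bs orbT.
under [RHS]eq_bigr do rewrite /= exprD.
rewrite big_split /=; congr (_ * _).
have /andP[a0 aK] := sP a (mem_head _ _).
have lt : (a.-1 < K)%N by lia.
rewrite (bigD1 (Ordinal lt)) //= prednK // eqxx expr1 big1 ?mulr1 // => i /eqP ne.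
by case: eqP => [e|]; rewrite ?expr0 //; case: ne; apply: val_inj => /=; lia.
Qed.

Lemma zee_big d K mu : is_partition d mu -> (d <= K)%N ->
  zee mu = (\prod_(i < K) (i.+1 ^ count_mem i.+1 mu * (count_mem i.+1 mu)`!))%N.
Proof.
move=> P dK; have /and3P[_ _ /eqP sE] := P.
rewrite /zee sE -(big_mkord xpredT (fun i => i.+1 ^ count_mem i.+1 mu * (count_mem i.+1 mu)`!)%N).
rewrite big_add1 /= [RHS](big_cat_nat _ (n := d)) //= [X in _ = (_ * X)%N]big_nat_cond.
rewrite [X in _ = (_ * X)%N]big1 ?muln1 // => i /andP[/andP[di _] _].
rewrite (count_memPn _) //; apply/negP => /(partition_le P); lia.
Qed.

(** The exponents i m_i(mu) that a partition mu selects in the product of the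
series exp(p_i u^i / i), i = 1, ..., K. *)
Definition part_counts K d (mu : seq nat) : {ffun 'I_K -> 'I_d.+1} :=
  [ffun i : 'I_K => inord (i.+1 * count_mem i.+1 mu)].

Lemma part_countsE K d mu i : is_partition d mu -> (d <= K)%N ->
  part_counts K d mu i = (i.+1 * count_mem i.+1 mu)%N :> nat.
Proof.
move=> P dK; rewrite ffunE inordK // ltnS.
have /and3P[_ _ /eqP {1}<-] := P.
rewrite sumnE (@big_count_sum id K) => [|a ain]; last first.
  by rewrite (partition_gt0 P ain) (leq_trans (partition_le P ain) dK).
by rewrite (bigD1 i) //= leq_addr.
Qed.

(** The coefficient of u^d in the product of the exp(p_i u^i / i), i <= K. The
nonzero terms of its expansion are those of the partitions of d; K need only be
at least d. *)
Lemma coef_prod_E K d : (d <= K)%N ->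
  (\prod_(i < K) tpoly d (E i.+1))`_d = cycle_index d.
Proof.
move=> dK; rewrite (coef_prod_tpoly d (fun i : 'I_K => E i.+1)).
rewrite (bigID (fun m : {ffun 'I_K -> 'I_d.+1} => [forall i : 'I_K, i.+1 %| m i]%N)) /=.
rewrite [X in _ + X]big1 ?addr0; last first.
  move=> m /andP[_ /forallPn[i ni]]; rewrite (bigD1 i) //= /E (negPf ni) mul0r //.
have Kpart mu a : is_partition d mu -> a \in mu -> (0 < a <= K)%N.
  by move=> P ain; rewrite (partition_gt0 P ain) (leq_trans (partition_le P ain) dK).
(* The exponents that come from a partition are the multiples of the indices. *)
pose Q (m : {ffun 'I_K -> 'I_d.+1}) :=
  (\sum_i m i == d)%N && [forall i : 'I_K, i.+1 %| m i]%N.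
have pe : perm_eq [seq part_counts K d mu | mu <- parts d] (filter Q (index_enum _)).
  apply: uniq_perm.
  - rewrite map_inj_in_uniq ?parts_uniq // => mu mu'; rewrite !mem_parts => P P' e.
    apply: (partition_eq P P'); apply/allP => a _ /=; apply/eqP.
    have [ale|agt] := boolP (0 < a <= K)%N; last first.
      by rewrite !(count_memPn _) //; apply/negP => /Kpart h; move: agt; rewrite h.
    have lt : (a.-1 < K)%N by lia.
    have := part_countsE (Ordinal lt) P dK; rewrite e part_countsE //= prednK; last by lia.
    by move=> /eqP; rewrite eqn_pmul2l; [move/eqP|lia].
  - by rewrite filter_uniq ?index_enum_uniq.
  move=> m; rewrite mem_filter mem_index_enum andbT; apply/mapP/idP => [[mu]|].
    rewrite mem_parts => P ->; apply/andP; split; last first.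
      by apply/forallP => i; rewrite part_countsE // dvdn_mulr.
    under eq_bigr do rewrite part_countsE //.
    have /and3P[_ _ /eqP<-] := P.
    by rewrite sumnE (@big_count_sum id K) // => a; apply: Kpart.
  case/andP=> /eqP sm /forallP dv.
  pose s := flatten [seq nseq (m i %/ i.+1) i.+1 | i <- enum 'I_K].
  have cs (i : 'I_K) : count_mem i.+1 s = (m i %/ i.+1)%N.
    rewrite count_flatten -map_comp sumnE big_map big_enum /= (bigD1 i) //=.
    rewrite count_nseq /= eqxx mul1n big1 ?addn0 // => j /eqP ne.
    by rewrite count_nseq /=; case: eqP => // -[e]; case: ne; apply: val_inj.
  have s0 : all (leq 1) s.
    apply/allP => a /flattenP[t /mapP[i _ ->]]; by rewrite mem_nseq => /andP[_ /eqP->].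
  have sumns : sumn s = d.
    rewrite sumn_flatten -map_comp sumnE big_map big_enum -[RHS]sm.
    by apply: eq_bigr => i _; rewrite /= sumn_nseq mulnC divnK ?dv.
  have P : is_partition d (partof s) by rewrite -sumns partof_partition.
  exists (partof s); first by rewrite mem_parts.
  apply/ffunP => i; apply: val_inj; rewrite /= part_countsE //.
  rewrite (seq.permP (perm_partof s)) (_ : filter _ s = s); last exact/all_filterP.
  by rewrite cs mulnC divnK ?dv.
rewrite /cycle_index -big_filter -(perm_big _ pe) big_map big_seq [RHS]big_seq.
apply: eq_bigr => mu; rewrite mem_parts => P.
rewrite (zee_big P dK) (@big_count_prod _ p K) => [|a]; last exact: Kpart.
rewrite natr_prod -prodf_div; apply: eq_bigr => i _.
rewrite part_countsE // /E dvdn_mulr // mulKn // natrM natrX expr_div_n.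
by rewrite invfM mulrA.
Qed.

Lemma cycle_index0 : cycle_index 0 = 1.
Proof. by rewrite -(@coef_prod_E 0 0) // big_ord0 coefC. Qed.

Lemma newton_cycle_index : newton cycle_index p.
Proof.
apply/newton_dlog => d.
have D (i : 'I_d) := (newton_dlog _ _).1 (newton_E (ltn0Sn i)) d.
apply: eq_dlog (dlog_prod (index_enum _) D) => m lem.
  rewrite coef_tpoly // -(coef_prod_E lem); apply: (@eq_coef_prod _ m) => // i j lej.
  by rewrite !coef_tpoly // (leq_trans lej).
rewrite coef_sum coef_tpoly0 //; under eq_bigr do rewrite coef_tpoly0 //.
case: m lem => [|m] lem /=; first by rewrite big1.
rewrite (bigD1 (Ordinal lem)) //= eqxx big1 ?addr0 // => i /eqP ne.
by case: eqP => // -[e]; case: ne; apply: val_inj.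
Qed.

End CycleIndex.

(** * Symmetric functions *)

(** A number field with a primitive n-th root of unity, and a Q-linear map phi to Q
that maps 1 to 1: a coordinate of K over Q which does not vanish at 1,
normalised. *)
Lemma cyclotomic_retraction n : (0 < n)%N ->
  exists (K : fieldExtType rat) (w : K) (phi : K -> rat),
  [/\ n.-primitive_root w, {morph phi : x y / x + y},
      forall x q, phi (x * q%:A) = phi x * q & phi 1 = 1].
Proof.
move=> n_gt0; have [z pz] := C_prim_root_exists n_gt0.
have [K [f [s1 fs _]]] := num_field_exists [:: z].
case: s1 fs => [|w [|? ?]] // [fw].
pose X := vbasis (fullv : {vspace K}).
have [i ci] : exists i, coord X i (1 : K) != 0.
  case: (pickP (fun i => coord X i (1 : K) != 0)) => [i ci|h]; first by exists i.
  have := coord_vbasis (memvf (1 : K)); rewrite big1 => [/eqP|i _].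
    by rewrite oner_eq0.
  by have /negbFE/eqP-> := h i; rewrite scale0r.
exists K, w, (fun x => coord X i x / coord X i 1); split.
- by rewrite -(fmorph_primitive_root f) fw.
- by move=> x y; rewrite linearD mulrDl.
- by move=> x q; rewrite -scalerAr mulr1 linearZ /= -mulrA mulrC.
by rewrite divff.
Qed.

Lemma sum_lt_ord (a K : nat) : (a <= K)%N -> (\sum_(r < K) (r < a))%N = a.
Proof.
move=> le; rewrite -[RHS]card_ord -sum1_card (big_ord_widen K (fun=> 1%N) le).
by rewrite [RHS]big_mkcond; apply: eq_bigr => r _; case: ifP.
Qed.

(** The notations of multivariate polynomials are confined to this module. *)
Module SymFunTheory.
Import mpoly.
Import SymFun.

Section Coefficients.
Variable N : nat.
Implicit Types (m : 'X_{1..N}) (p : {mpoly rat[N]}).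

(** Sums over monomials are bounded to be finite; the bound d is harmless when it
exceeds the degrees of the selected monomials. *)
Lemma mcoeff_sum_monomials d (P : pred 'X_{1..N}) m :
  (forall m, P m -> (mdeg m < d)%N) ->
  (\sum_(m' : 'X_{1..N < d} | P m') 'X_[m'] : {mpoly rat[N]})@_m = (P m)%:R.
Proof.
move=> Pd; rewrite raddf_sum /=; under eq_bigr do rewrite mcoeffX.
have [Pm|nPm] := boolP (P m).
  rewrite (bigD1 (BMultinom (Pd m Pm))) //= eqxx big1 ?addr0 // => m' /andP[_ ne].
  by rewrite (negPf (_ : (m' : 'X_{1..N}) != m)) //; apply: contra_neq ne => e; apply: val_inj.
by rewrite big1 // => m' Pm'; case: eqP => // e; move: nPm; rewrite -e Pm'.
Qed.

Lemma mcoeff_h k m : (h k N)@_m = (mdeg m == k)%:R.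
Proof. by rewrite (@mcoeff_sum_monomials _ (fun m => mdeg m == k)) // => ? /eqP->. Qed.

Lemma sumn_multinom m : sumn [seq a <- m | (0 < a)%N] = mdeg m.
Proof.
by rewrite -(perm_sumn (perm_partof m)) sumn_partof sumnE.
Qed.

Lemma mcoeff_mpart la m :
  (mpart la N)@_m = (perm_eq [seq a <- m | (0 < a)%N] la)%:R.
Proof.
rewrite (@mcoeff_sum_monomials _ (fun m : 'X_{1..N} => perm_eq [seq a <- m | (0 < a)%N] la)) //.
by move=> m' /perm_sumn; rewrite sumn_multinom => ->.
Qed.

Lemma msize_le_mcoeff d p :
  (forall m, (d <= mdeg m)%N -> p@_m = 0) -> (msize p <= d)%N.
Proof.
move=> p0; rewrite msizeE; apply/bigmax_leqP_seq => m; rewrite mcoeff_msupp => pm _.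
by rewrite ltnNge; apply: contra pm => /p0 ->.
Qed.

Lemma mcoeff_mulX p m' m :
  (p * 'X_[m'])@_m = if (m' <= m)%MM then p@_(m - m') else 0.
Proof.
case: ifP => [le|nle]; first by rewrite -{1}(submK le) addmC mcoeffMX.
rewrite {1}[p]mpolyE mulr_suml raddf_sum big1 // => m'' _ /=.
rewrite -scalerAl -mpolyXD mcoeffZ mcoeffX; case: eqP => [e|]; rewrite ?mulr0 //.
by move: nle; rewrite -e lem_addl.
Qed.

Definition power_sum (r : nat) : {mpoly rat[N]} := \sum_(i < N) 'X_i ^+ r.

(** The Newton identities k h_k = \sum_(1 <= r <= k) p_r h_(k-r): a monomial of
degree k with exponents m_i occurs once in x_i^r h_(k-r) for each
1 <= r <= m_i, hence k times in all. *)
Lemma newton_h : newton (fun k => h k N) power_sum.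
Proof.
move=> k; apply/mpolyP => m; rewrite mcoeffMn mcoeff_h raddf_sum /=.
have E (r : 'I_k) : (power_sum r.+1 * h (k - r.+1) N)@_m =
    (mdeg m == k)%:R * \sum_(i < N) (r < m i)%N%:R.
  rewrite /power_sum mulr_suml raddf_sum mulr_sumr; apply: eq_bigr => i _ /=.
  have le1 : (U_(i) *+ r.+1 <= m)%MM = (r < m i)%N.
    apply/mnm_lepP/idP => [/(_ i)|lt j]; rewrite mulmnE mnm1E ?eqxx ?mul1n //.
    by case: eqP => [<-|]; rewrite ?mul1n.
  rewrite mulrC mpolyXn mcoeff_mulX le1; case: ifP => lt; rewrite ?mulr0 // mulr1.
  rewrite mcoeff_h; congr (_ : bool)%:R.
  have := mdegB m (U_(i) *+ r.+1); have := ltn_ord r.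
  have le : (U_(i) *+ r.+1 <= m)%MM by rewrite le1.
  have := mdegD (m - U_(i) *+ r.+1) (U_(i) *+ r.+1).
  rewrite (submK le) mdegMn mdeg1; lia.
under eq_bigr do rewrite E.
rewrite -mulr_sumr exchange_big /=; case: eqP => [mk|]; rewrite ?mul0r ?mul0rn // mul1r.
rewrite -[in LHS]mk mdegE natr_sum; apply: eq_bigr => i _.
rewrite -natr_sum; congr (_%:R).
have le : (m i <= k)%N by rewrite -mk mdegE (bigD1 i) //= leq_addr.
by rewrite sum_lt_ord.
Qed.

End Coefficients.

Section Restriction.
Variable N : nat.

(** The monomial m in one more variable, with exponent 0. *)
Definition extend (m : 'X_{1..N}) : 'X_{1..N.+1} :=
  [multinom if unlift ord_max i is Some j then m j else 0%N | i < N.+1].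

(** Setting the last variable to 0 keeps the monomials that do not contain it. *)
Lemma mcoeff_restrict (p : {mpoly rat[N.+1]}) m : (restrict p)@_m = p@_(extend m).
Proof.
rewrite /restrict comp_mpolyEX [p in RHS]mpolyE !raddf_sum; apply: eq_bigr => m' _ /=.
rewrite !mcoeffZ comp_mpolyX mcoeffX; congr (_ * _).
rewrite (bigD1_ord ord_max) //= tnth_mktuple unlift_none.
under eq_bigr do rewrite tnth_mktuple liftK.
have ext_lift j : extend m (lift ord_max j) = m j by rewrite mnmE liftK.
have ext_max : extend m ord_max = 0%N by rewrite mnmE unlift_none.
rewrite expr0n; case: eqP => [m0|mN0]; last first.
  by rewrite mul0r mcoeff0; case: eqP => // e; case: mN0; rewrite e.
have -> : \prod_(j < N) 'X_j ^+ m' (lift ord_max j) =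
    'X_[[multinom m' (lift ord_max j) | j < N]] :> {mpoly rat[N]}.
  by rewrite mpolyXE_id; apply: eq_bigr => j _; rewrite mnmE.
rewrite mul1r mcoeffX; congr (_ : bool)%:R; apply/eqP/eqP => [<-|->]; apply/mnmP => i.
  by rewrite mnmE; case: unliftP => [j ->|->]; rewrite ?mnmE.
by rewrite mnmE ext_lift.
Qed.

Lemma mdeg_extend m : mdeg (extend m) = mdeg m.
Proof.
rewrite !mdegE (bigD1_ord ord_max) //= mnmE unlift_none add0n.
by apply: eq_bigr => i _; rewrite mnmE liftK.
Qed.

Lemma perm_extend m :
  perm_eq [seq a <- extend m | (0 < a)%N] [seq a <- m | (0 < a)%N].
Proof.
have E n (m' : 'X_{1..n}) : [seq a <- m' | (0 < a)%N] =
    [seq a <- [seq m' i | i <- enum 'I_n] | (0 < a)%N].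
  congr filter; apply: (@eq_from_nth _ 0%N).
    by rewrite size_map size_enum_ord size_tuple.
  move=> i; rewrite size_tuple => lt.
  by rewrite (nth_map (Ordinal lt)) ?size_enum_ord // (mnm_nth 0%N) nth_enum_ord.
rewrite !E; apply/seq.permP => P; rewrite !count_filter [LHS]count_map [RHS]count_map.
rewrite -!sum1_count !big_enum_cond /= [LHS]big_mkcond [RHS]big_mkcond (bigD1_ord ord_max) //=.
by rewrite mnmE unlift_none andbF; apply: eq_bigr => i _; rewrite mnmE liftK.
Qed.

End Restriction.

Lemma symfun_h k : symfun (h k).
Proof.
split=> [N|N|].
- apply/issymP => s; apply/mpolyP => m; by rewrite mcoeff_sym !mcoeff_h mdeg_mperm.
- by apply/mpolyP => m; rewrite mcoeff_restrict !mcoeff_h mdeg_extend.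
exists k.+1 => N; apply: msize_le_mcoeff => m; rewrite mcoeff_h.
by case: eqP => // ->; rewrite ltnn.
Qed.

Lemma symfun_mpart la : symfun (mpart la).
Proof.
split=> [N|N|].
- apply/issymP => s; apply/mpolyP => m; rewrite mcoeff_sym !mcoeff_mpart.
  congr (_ : bool)%:R; apply: permPl; apply: perm_filter.
  apply/tuple_permP; exists s.
  by congr tval; apply: eq_from_tnth => i; rewrite !tnth_mktuple.
- apply/mpolyP => m; rewrite mcoeff_restrict !mcoeff_mpart.
  by rewrite (permPl (perm_extend m)).
exists (sumn la).+1 => N; apply: msize_le_mcoeff => m; rewrite mcoeff_mpart.
case: (boolP (perm_eq _ _)) => // /perm_sumn; rewrite sumn_multinom => ->.
by rewrite ltnn.
Qed.

Lemma symfun_mul f g : symfun f -> symfun g -> symfun (fun N => f N * g N).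
Proof.
move=> [fs fr [d fd]] [gs gr [e ge]]; split=> [N|N|].
- by apply: rpredM; [apply: fs | apply: gs].
- by rewrite -(fr N) -(gr N); apply: (rmorphM (comp_mpoly _)).
exists (d + e).+1 => N; apply: leq_trans (msizeM_le _ _) _.
by rewrite ltnS leq_add.
Qed.

Lemma symfun_const c : symfun (fun N => c%:MP).
Proof.
split=> [N|N|].
- by apply/issymP => s; apply/mpolyP => m; rewrite mcoeff_sym !mcoeffC -!mdeg_eq0 mdeg_mperm.
- by rewrite /restrict comp_mpolyC.
by exists 1%N => N; rewrite msizeC leq_b1.
Qed.

Lemma symfun_lincomb c f g : symfun f -> symfun g -> symfun (lincomb c f g).
Proof.
move=> [fs fr [d fd]] [gs gr [e ge]]; split=> [N|N|].
- by apply: rpredD; [apply/rpredZ/fs | apply: gs].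
- by rewrite /lincomb /restrict comp_mpolyD comp_mpolyZ -!/(restrict _) fr gr.
exists (maxn d e) => N; apply: leq_trans (msizeD_le _ _) _.
rewrite geq_max (leq_trans (msizeZ_le _ _)) ?(leq_trans (fd N)) ?leq_maxl //=.
by rewrite (leq_trans (ge N)) ?leq_maxr.
Qed.

Lemma symfun_hpart la : symfun (hpart la).
Proof.
elim: la => [|a la IHla].
  rewrite (_ : hpart [::] = fun N => 1%:MP); first exact: symfun_const.
  by apply: boolp.functional_extensionality_dep => N; rewrite /hpart big_nil.
rewrite (_ : hpart (a :: la) = fun N => h a N * hpart la N); last first.
  by apply: boolp.functional_extensionality_dep => N; rewrite /hpart big_cons.
exact: symfun_mul (symfun_h a) IHla.
Qed.

Section ScalarProduct.
Variable sp : family -> family -> rat.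
Hypothesis spP : standard_scalar_product sp.

Lemma scalar_product_sum (I : Type) (s : seq I) (c : I -> rat) (f : I -> family) u :
  (forall i, symfun (f i)) -> symfun u ->
  symfun (fun N => \sum_(i <- s) c i *: f i N) /\
  sp (fun N => \sum_(i <- s) c i *: f i N) u = \sum_(i <- s) c i * sp (f i) u.
Proof.
move=> fS uS; have [spl _ _] := spP; elim: s => [|i s [IHS IHs]].
  have E0 : (fun N => \sum_(i <- [::]) c i *: f i N) = fun N => 0%:MP :> {mpoly rat[N]}.
    by apply: boolp.functional_extensionality_dep => N; rewrite big_nil.
  have S0 := symfun_const 0; rewrite E0 big_nil; split=> //.
  have := spl (-1) _ _ _ S0 S0 uS; rewrite mulN1r addNr => {2}<-; congr sp.
  apply: boolp.functional_extensionality_dep => N.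
  by rewrite /lincomb scaleN1r addNr.
have -> : (fun N => \sum_(j <- i :: s) c j *: f j N) =
    lincomb (c i) (f i) (fun N => \sum_(j <- s) c j *: f j N).
  by apply: boolp.functional_extensionality_dep => N; rewrite big_cons.
by split; [apply: symfun_lincomb | rewrite spl // IHs big_cons].
Qed.

End ScalarProduct.

(** The substitution x_i -> x_i^n in the identities for the h_k. *)
Lemma newton_plethysm n N :
  newton (fun k => plethysm_p n (h k) N) (fun r => power_sum N (n * r)).
Proof.
have := newton_map (comp_mpoly [tuple 'X_i ^+ n | i < N]) (newton_h N).
apply: eq_newton => // r _; rewrite /power_sum rmorph_sum; apply: eq_bigr => i _ /=.
by rewrite rmorphXn /= comp_mpolyXU nth_mktuple -exprM.
Qed.

Section Plethysm.
Variables (n k : nat).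
Variables (K : fieldExtType rat) (w : K) (phi : K -> rat).
Hypotheses (n_gt0 : (0 < n)%N) (pw : n.-primitive_root w).
Hypothesis phiD : {morph phi : x y / x + y}.
Hypothesis phiZ : forall x q, phi (x * q%:A) = phi x * q.
Hypothesis phi1 : phi 1 = 1.

Let phi0 : phi 0 = 0.
Proof. by apply: (addrI (phi 0)); rewrite -phiD !addr0. Qed.
Let phi_sum (I : finType) (P : pred I) (F : I -> K) :
  phi (\sum_(i | P i) F i) = \sum_(i | P i) phi (F i).
Proof. exact: (big_morph phi phiD phi0). Qed.

Let weight (m : {ffun 'I_n -> 'I_(n * k).+1}) : K := w ^+ (\sum_(i < n) i.+1 * m i)%N.

Lemma torsion_free_ext : torsion_free K.
Proof.
move=> m x m0; rewrite -scaler_nat => /eqP; rewrite scaler_eq0 pnatr_eq0.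
by case: m m0 => //= m _ /eqP.
Qed.

(** p_n o h_k as a rational combination of products of at most n complete symmetric
functions. The individual coefficients phi(w^(...)) depend on phi and w; their
sums over the families m with the same parts do not. *)
Lemma plethysm_expansion :
  plethysm_p n (h k) = fun N =>
    \sum_(m : {ffun 'I_n -> 'I_(n * k).+1} | (\sum_i m i == n * k)%N)
      phi (weight m) *: hpart (ffun_part m) N.
Proof.
apply: boolp.functional_extensionality_dep => N.
pose f := map_mpoly (in_alg K) : {mpoly rat[N]} -> {mpoly K[N]}.
have tf : torsion_free {mpoly K[N]}.
  move=> m x m0 e; apply/mpolyP => mm; rewrite mcoeff0; apply: (torsion_free_ext m0).
  by rewrite -mcoeffMn e mcoeff0.
have wS r : \sum_(j < n) (w%:MP : {mpoly K[N]}) ^+ (j.+1 * r) =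
    if (n %| r)%N then n%:R else 0.
  under eq_bigr do rewrite -rmorphXn.
  by rewrite -rmorph_sum (sum_unity_powers _ pw); case: ifP; rewrite ?rmorph_nat ?rmorph0.
have h0 : h 0 N = 1.
  by apply/mpolyP => m; rewrite mcoeff_h mcoeff1 mdeg_eq0.
(* The product formula holds over K; phi is then applied to each coefficient. *)
have := root_of_unity_product k tf n_gt0 wS (newton_map f (newton_h N)) _
  (newton_map f (newton_plethysm n N)) _.
rewrite h0 /plethysm_p h0 !rmorph1 => /(_ erefl erefl) E.
apply/mpolyP => mm; have := congr1 (fun p => phi p@_mm) E.
rewrite /f mcoeff_map_mpoly /= -[_%:A]mul1r phiZ phi1 mul1r => <-.
rewrite !raddf_sum phi_sum; apply: eq_bigr => m _ /=.
rewrite -rmorph_prod -rmorphXn /= mcoeffCM mcoeff_map_mpoly /= phiZ mcoeffZ.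
by rewrite /hpart (big_ffun_part _ _ h0).
Qed.

Variables (b q : nat -> rat) (sp : family -> family -> rat).
Hypotheses (spP : standard_scalar_product sp) (Nb : newton b q) (b0 : b 0%N = 1).

Lemma scalar_product_plethysm la : is_partition (n * k) la ->
  sp (plethysm_p n (h k)) (mpart la) =
  \sum_(m : {ffun 'I_n -> 'I_(n * k).+1} | (\sum_i m i == n * k)%N)
    phi (weight m) * (ffun_part m == la)%:R.
Proof.
move=> P; rewrite plethysm_expansion; have [_ _ dual] := spP.
set s := [seq m : {ffun 'I_n -> 'I_(n * k).+1} <- index_enum _ | (\sum_i m i == n * k)%N].
have [_] := scalar_product_sum spP s (fun m => phi (weight m))
  (fun m => symfun_hpart (ffun_part m)) (symfun_mpart la).
have <- : (fun N => \sum_(m <- s) phi (weight m) *: hpart (ffun_part m) N) =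
    (fun N => \sum_(m : {ffun 'I_n -> 'I_(n * k).+1} | (\sum_i m i == n * k)%N)
      phi (weight m) *: hpart (ffun_part m) N).
  by apply: boolp.functional_extensionality_dep => N; rewrite big_filter.
rewrite big_filter => ->; apply: eq_bigr => m _.
by rewrite (dual _ _ _ _ (ffun_part_partition m) P).
Qed.

Lemma plethysm_specialization :
  \sum_(la <- parts (n * k) | (size la <= n)%N)
    sp (plethysm_p n (h k)) (mpart la) * \prod_(i <- la) b i =
  cycle_index (fun r => q (n * r)%N) k.
Proof.
transitivity (\sum_(m : {ffun 'I_n -> 'I_(n * k).+1} | (\sum_i m i == n * k)%N)
    phi (weight m) * \prod_(i < n) b (m i)).
  rewrite big_seq_cond.
  under eq_bigr => la /andP[lain _].
    rewrite scalar_product_plethysm -?mem_parts // mulr_suml. over.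
  rewrite -big_seq_cond exchange_big /=; apply: eq_bigr => m /eqP sm.
  have lain : ffun_part m \in parts (n * k).
    by rewrite mem_parts; have := ffun_part_partition m; rewrite sm.
  rewrite big_mkcond (bigD1_seq (ffun_part m)) ?parts_uniq //=.
  rewrite size_ffun_part eqxx mulr1 [X in _ + X]big1 ?addr0 => [|la ne]; last first.
    by rewrite eq_sym (negPf ne) mulr0 mul0r if_same.
  by rewrite (big_ffun_part _ _ b0).
pose f := in_alg K : {rmorphism rat -> K}.
have := root_of_unity_product k torsion_free_ext n_gt0
  (fun r => sum_unity_powers r pw) (newton_map f Nb) _
  (newton_map f (newton_cycle_index (fun r => q (n * r)%N))) _.
rewrite b0 cycle_index0 rmorph1 => /(_ erefl erefl) E.
have := congr1 phi E; rewrite phi_sum.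
rewrite /= -[_%:A]mul1r phiZ phi1 mul1r => <-; apply: eq_bigr => m _.
by rewrite -(rmorph_prod f) phiZ.
Qed.
End Plethysm.

(** The ring homomorphism h_m -> b_m maps p_n o h_k to the coefficient attached to
the logarithmic derivative \sum_r q_(nr) t^r. The sum over partitions is
regrouped into the sum over exponents (m_1, ..., m_n) of
[plethysm_expansion], which is evaluated by [root_of_unity_product] in K. *)
Theorem scalar_product_formula n k sp (b q : nat -> rat) :
  (0 < n)%N -> standard_scalar_product sp -> newton b q -> b 0%N = 1 ->
  \sum_(la <- parts (n * k) | (size la <= n)%N)
    sp (plethysm_p n (h k)) (mpart la) * \prod_(i <- la) b i =
  cycle_index (fun r => q (n * r)%N) k.
Proof.
move=> n_gt0 spP Nb b0; have [K [w [phi [pw phiD phiZ phi1]]]] := cyclotomic_retraction n_gt0.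
exact: plethysm_specialization n_gt0 pw phiD phiZ phi1 _ _ _ spP Nb b0.
Qed.
End SymFunTheory.

From mathcomp Require Import all_classical all_reals all_analysis.
From mathcomp Require Import complex.
Import Order.TTheory GRing.Theory Num.Theory numFieldNormedType.Exports.
Local Open Scope classical_set_scope.
Local Open Scope ring_scope.

(** * The generating series of the truncated sums *)

Lemma big_tuple_cons (V : nmodType) (T : finType) k (P : pred (seq T)) (F : seq T -> V) :
  \sum_(t : k.+1.-tuple T | P t) F t =
  \sum_(x : T) \sum_(t : k.-tuple T | P (x :: t)) F (x :: t).
Proof.
rewrite pair_big_dep /= (reindex (fun u : T * k.-tuple T => [tuple of u.1 :: u.2])) //=.
exists (fun t : k.+1.-tuple T => (thead t, [tuple of behead t])).
  by move=> [x t] _ /=; congr pair; apply: val_inj.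
by move=> t _; apply: val_inj => /=; case: (tupleP t).
Qed.

(** For an empty s the default x.+1 of the head makes the factor eps x x.+1
equal to 1. *)
Lemma eps_seq_cons x s : eps_seq (x :: s) = (eps x (head x.+1 s) * eps_seq s)%N.
Proof.
case: s => [|y s]; last by rewrite /eps_seq /= big_ord_recl.
by rewrite /eps_seq /= !big_ord0 /eps ltn_eqF.
Qed.

Section Partial.
Variables (R : realType) (s N : nat).

Let w (x : nat) : R := (-1) ^+ x / x%:R ^+ s.

Lemma pamzv_term_cons x t :
  pamzv_term R s (x :: t) = w x * (eps x (head x.+1 t))%:R * pamzv_term R s t.
Proof.
rewrite /pamzv_term eps_seq_cons natrM big_cons /= exprD invfM /w.
set e1 := _%:R; set e2 := _%:R; ring.
Qed.

(** The sum over m <= i_1 <= ... <= i_k <= N. *)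
Definition tail_sum (k m : nat) : R :=
  \sum_(t : k.-tuple 'I_N.+1 | path leq m [seq val i | i <- t])
    pamzv_term R s [seq val i | i <- t].

(** The sum over m = i_0 <= i_1 <= ... <= i_k <= N. *)
Definition first_sum (k m : nat) : R :=
  \sum_(t : k.-tuple 'I_N.+1 | path leq m [seq val i | i <- t])
    pamzv_term R s (m :: [seq val i | i <- t]).

Lemma tail_sum0 m : tail_sum 0 m = 1.
Proof.
rewrite /tail_sum (big_pred1 [tuple]) => [|t]; last by rewrite tuple0 /= [RHS]eqxx.
by rewrite /pamzv_term /eps_seq /= big_nil big_ord0 expr0 divr1 mulr1.
Qed.

Lemma tail_sumS k m : tail_sum k.+1 m = \sum_(m <= x < N.+1) first_sum k x.
Proof.
rewrite /tail_sum (big_tuple_cons k (fun t => path leq m [seq val i | i <- t])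
  (fun t => pamzv_term R s [seq val i | i <- t])) /=.
rewrite (big_nat_widenl _ 0) //.
rewrite big_mkord [RHS]big_mkcond /=; apply: eq_bigr => x _.
by case: leqP => lex //; rewrite big_pred0.
Qed.

Lemma tail_sum_end k : tail_sum k.+1 N.+1 = 0.
Proof. by rewrite tail_sumS big_geq. Qed.

Lemma tail_sum_rec k m : (m <= N)%N ->
  tail_sum k.+1 m = tail_sum k.+1 m.+1 + first_sum k m.
Proof. by move=> lemN; rewrite !tail_sumS big_ltn // addrC. Qed.

Lemma path_leqS m t : path leq m.+1 t = (head m.+1 t != m) && path leq m t.
Proof.
case: t => [|y t] /=; first by rewrite gtn_eqF.
by rewrite ltn_neqAle eq_sym andbA.
Qed.

(** An odd first index may not be repeated, an even one may. *)
Lemma first_sumE k m : first_sum k m = w m * tail_sum k (if odd m then m.+1 else m).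
Proof.
rewrite /first_sum /tail_sum mulr_sumr big_mkcond [RHS]big_mkcond /=.
apply: eq_bigr => t _; rewrite pamzv_term_cons /eps [m == _]eq_sym.
case: (odd m); rewrite ?andbF ?andbT ?mulr1 // path_leqS.
by case: eqP; rewrite //= ?mulr1 // mulr0 mul0r if_same.
Qed.

(** By descending induction on m: the generating series of the [tail_sum] from m is
the one from m + 1 multiplied by 1 - m^-s u if m is odd, and divided by it if m
is even. *)
Lemma newton_tail_sum m : (m <= N.+1)%N ->
  newton (fun k => tail_sum k m)
         (fun r => \sum_(m <= x < N.+1) (-1) ^+ x * (x%:R ^+ s)^-1 ^+ r).
Proof.
move=> lem; rewrite -(subKn lem); have := leq_subr m N.+1.
elim: (N.+1 - m)%N => [|j IHj] ltj.
  rewrite subn0; apply: (@eq_newton _ (fun k => (k == 0)%N%:R) _ (fun=> 0)).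
  - by case=> [|k]; rewrite ?tail_sum0 ?tail_sum_end.
  - by move=> r _; rewrite big_geq.
  by case=> [|k]; rewrite ?big_ord0 ?mul0rn // big1 // => i _; rewrite mul0r.
have {IHj} := IHj (ltnW ltj); set m' := (N.+1 - j.+1)%N.
have -> : (N.+1 - j = m'.+1)%N by rewrite /m'; lia.
have lem' : (m' <= N)%N by rewrite /m'; lia.
move=> Nm; have rec k := tail_sum_rec k lem'.
pose a : R := (m'%:R ^+ s)^-1; have Ng := newton_geometric a.
have wE : w m' = (-1) ^+ odd m' * a by rewrite /w signr_odd.
have [om|em] := boolP (odd m').
  have h : forall i, tail_sum i m'.+1 = \sum_(l < i.+1) a ^+ l * tail_sum (i - l) m'.
    apply: (@geometric_conv _ a (fun i => tail_sum i m') (fun i => tail_sum i m'.+1)).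
      by rewrite !tail_sum0.
    by move=> k; rewrite rec first_sumE om wE om; ring.
  have := newton_div (b := fun k => tail_sum k m') (expr0 _) h Ng Nm.
  apply: eq_newton => // r _.
  by rewrite [RHS]big_ltn // -[in RHS]signr_odd om addrC /a expr1 mulN1r.
have h : forall i, tail_sum i m' = \sum_(l < i.+1) a ^+ l * tail_sum (i - l) m'.+1.
  apply: (@geometric_conv _ a (fun i => tail_sum i m'.+1) (fun i => tail_sum i m')).
    by rewrite !tail_sum0.
  by move=> k; rewrite rec first_sumE (negPf em) wE (negPf em); ring.
have := newton_mul (c := fun i => tail_sum i m') h Ng Nm.
apply: eq_newton => // r _.
by rewrite [RHS]big_ltn // -[in RHS]signr_odd (negPf em) /a mul1r.
Qed.

End Partial.

Lemma newton_pamzv_partial (R : realType) (s N : nat) :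
  newton (fun k => pamzv_partial R k s N)
         (fun r => \sum_(1 <= x < N.+1) (-1) ^+ x * (x%:R ^+ s)^-1 ^+ r).
Proof. exact: newton_tail_sum. Qed.

Lemma pamzv_partial0 (R : realType) (s N : nat) : pamzv_partial R 0 s N = 1.
Proof. exact: tail_sum0. Qed.

(** * Limits in Newton's identities *)

Section NewtonLimits.
Variable R : realType.
Implicit Types (a p : nat -> nat -> R) (b q : nat -> R).

Lemma cvg_sum_ord (n : nat) (f : nat -> nat -> R) (l : nat -> R) :
  (forall i, (i < n)%N -> f i @ \oo --> l i) ->
  (fun N => \sum_(i < n) f i N) @ \oo --> \sum_(i < n) l i.
Proof.
elim: n => [|n IHn] fl.
  under eq_fun do rewrite big_ord0.
  by rewrite big_ord0; apply: cvg_cst.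
under eq_fun do rewrite big_ord_recr.
rewrite big_ord_recr /=; apply: cvgD; last exact: fl.
by apply: IHn => i lti; apply: fl; rewrite ltnW.
Qed.

Lemma cvg_newton_coef a p b q :
  (forall N, newton (a N) (p N)) -> newton b q ->
  (forall N, a N 0%N = b 0%N) ->
  (forall r, (0 < r)%N -> p ^~ r @ \oo --> q r) ->
  forall k, a ^~ k @ \oo --> b k.
Proof.
move=> Na Nb a0 pq; elim/ltn_ind => -[_|k IHk].
  by under eq_fun do rewrite a0; apply: cvg_cst.
have solve (x y : nat -> R) : newton x y ->
    x k.+1 = k.+1%:R^-1 * \sum_(r < k.+1) y r.+1 * x (k.+1 - r.+1)%N.
  by move=> <-; rewrite -[x k.+1 *+ _]mulr_natl mulKf ?pnatr_eq0.
rewrite (solve _ _ Nb).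
under eq_fun do rewrite (solve _ _ (Na _)).
apply: cvgMl_tmp; apply: (cvg_sum_ord (f := fun r N => p N r.+1 * a N (k.+1 - r.+1)%N)
  (l := fun r => q r.+1 * b (k.+1 - r.+1)%N)) => r ltr.
by apply: cvgM; [apply: pq | apply: IHk; lia].
Qed.

Lemma cvg_newton_powers a p b q :
  (forall N, newton (a N) (p N)) -> newton b q ->
  (forall N, a N 0%N = 1) -> b 0%N = 1 ->
  (forall k, a ^~ k @ \oo --> b k) ->
  forall r, (0 < r)%N -> p ^~ r @ \oo --> q r.
Proof.
move=> Na Nb a0 b0 ab; elim/ltn_ind => -[//|k] IHk _.
have solve (x y : nat -> R) : newton x y -> x 0%N = 1 ->
    y k.+1 = x k.+1 *+ k.+1 - \sum_(r < k) y r.+1 * x (k.+1 - r.+1)%N.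
  by move=> -> x0; rewrite big_ord_recr /= subnn x0 mulr1 [_ + y _]addrC addrK.
rewrite (solve _ _ Nb b0).
under eq_fun do rewrite (solve _ _ (Na _) (a0 _)).
apply: cvgB; first exact: cvgMn.
apply: (cvg_sum_ord (f := fun r N => p N r.+1 * a N (k.+1 - r.+1)%N)
  (l := fun r => q r.+1 * b (k.+1 - r.+1)%N)) => r ltr.
by apply: cvgM; [apply: IHk; lia | apply: ab].
Qed.

End NewtonLimits.

(** * Euler's evaluation of the zeta values *)

Section Cotangent.
Variable R : realType.
Implicit Types x : R.

(** By the mean value theorem, sin x = x cos c for some 0 < c < x. *)
Lemma sin_between x : 0 < x < pi / 2 -> x * cos x <= sin x <= x.
Proof.
move=> /andP[x0 xpi].
have pi2 : pi / 2 <= pi :> R by rewrite ler_pdivrMr // ler_peMr ?pi_ge0 // ler1n.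
have [c] := @MVT R (@sin R) (@cos R) 0 x x0 (fun y _ => is_derive_sin y)
  (@continuous_subspaceT _ _ _ _ (@continuous_sin R)).
rewrite in_itv /= => /andP[c0 cx]; rewrite sin0 !subr0 => ->.
rewrite ler_piMl ?cos_le1 ?(ltW x0) // andbT mulrC ler_wpM2r ?(ltW x0) //.
rewrite ltW // ltr_cos // in_itv /=; lra.
Qed.

Lemma de_moivre x n :
  ((cos x)%:C%C + 'i%C * (sin x)%:C%C) ^+ n = (cos (x *+ n))%:C%C + 'i%C * (sin (x *+ n))%:C%C.
Proof.
elim: n => [|n IHn]; first by rewrite mulr0n cos0 sin0 mulr0 addr0.
rewrite exprS IHn mulrS cosD sinD.
by apply/eqP; rewrite eq_complex /=; apply/andP; split; apply/eqP; ring.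
Qed.

(** The imaginary part of (cos x + i sin x)^(2M + 1). *)
Lemma sin_odd_multiple x M :
  sin (x *+ M.*2.+1) = \sum_(k < M.+1) (-1) ^+ k * 'C(M.*2.+1, k.*2.+1)%:R *
    cos x ^+ (M - k).*2 * sin x ^+ k.*2.+1.
Proof.
set N := M.*2.+1; set c := cos x; set s := sin x.
pose A k : R := (-1) ^+ k * 'C(N, k.*2)%:R * c ^+ (N - k.*2) * s ^+ k.*2.
pose B k : R := (-1) ^+ k * 'C(N, k.*2.+1)%:R * c ^+ (M - k).*2 * s ^+ k.*2.+1.
have i2 k : 'i%C ^+ k.*2 = ((-1) ^+ k)%:C%C :> R[i].
  by rewrite -mul2n exprM sqr_i rmorphXn rmorphN1.
have monom e b p q : (((-1) ^+ e * b%:R * c ^+ p * s ^+ q)%:C =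
    (-1) ^+ e * b%:R * c%:C ^+ p * s%:C ^+ q)%C.
  by rewrite !rmorphM !rmorphXn rmorphN1 rmorph_nat.
have : (c%:C%C + 'i%C * s%:C%C) ^+ N =
    (\sum_(k < M.+1) A k)%:C%C + 'i%C * (\sum_(k < M.+1) B k)%:C%C.
  rewrite exprDn -doubleS (big_ord_double M.+1
    (fun j => c%:C%C ^+ (N - j) * ('i%C * s%:C%C) ^+ j *+ 'C(N, j))).
  rewrite !rmorph_sum mulr_sumr -big_split /=; apply: eq_bigr => k _.
  have -> : (N - k.*2.+1 = (M - k).*2)%N by rewrite /N; lia.
  rewrite [(A k)%:C%C]monom [(B k)%:C%C]monom.
  set u := c%:C%C; set y := s%:C%C.
  rewrite [('i%C * y) ^+ k.*2]exprMn [('i%C * y) ^+ k.*2.+1]exprMn.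
  rewrite [X in X * y ^+ k.*2.+1]exprS i2.
  rewrite rmorphXn rmorphN1.
  rewrite -[X in X + _]mulr_natr -[X in _ + X]mulr_natr.
  by move: ('C(_, _)) ('C(_, _)) => b1 b2; ring.
rewrite de_moivre => /eqP; rewrite eq_complex => /andP[_ /eqP /=].
by rewrite !(mul0r, mul1r, add0r, addr0, mulr0).
Qed.

(** The polynomial Q with sin ((2M + 1) x) = sin x cos^(2M) x Q(tan^2 x). *)
Definition sine_poly (M : nat) : {poly R} :=
  \poly_(k < M.+1) ((-1) ^+ k * 'C(M.*2.+1, k.*2.+1)%:R).

Lemma sine_polyP x M : cos x != 0 ->
  sin (x *+ M.*2.+1) = sin x * cos x ^+ M.*2 * (sine_poly M).[tan x ^+ 2].
Proof.
move=> cN0; rewrite sin_odd_multiple horner_poly mulr_sumr; apply: eq_bigr => k _.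
have -> : M.*2 = ((M - k).*2 + k.*2)%N by have := ltn_ord k; lia.
rewrite exprD exprS /tan -exprM mul2n expr_div_n.
by field; rewrite expf_neq0.
Qed.

(** The angle (j + 1) pi / (2M + 1), which lies in ]0, pi / 2[ for j < M. *)
Definition node (M j : nat) : R := j.+1%:R * pi / M.*2.+1%:R.

Lemma node_itv M j : (j < M)%N -> 0 < node M j < pi / 2.
Proof.
move=> ltjM; have pi0 := @pi_gt0 R; rewrite /node; apply/andP; split.
  by rewrite divr_gt0 ?mulr_gt0 ?ltr0n.
rewrite ltr_pdivrMr ?ltr0n // [X in X < _]mulrC -[X in _ < X]mulrA ltr_pM2l //.
rewrite ltr_pdivlMl ?ltr0n // -natrM ltr_nat; lia.
Qed.

Lemma node_cos_gt0 M j : (j < M)%N -> 0 < cos (node M j).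
Proof. by move=> /node_itv h; apply: cos_gt0_pihalf; have := @pi_gt0 R; lra. Qed.

Lemma node_sin_gt0 M j : (j < M)%N -> 0 < sin (node M j).
Proof. by move=> /node_itv; apply: sin_gt0_pihalf. Qed.

Lemma sin_natpi j : sin (pi *+ j) = 0 :> R.
Proof. by elim: j => [|j IHj]; rewrite ?mulr0n ?sin0 // mulrSr sinDpi IHj oppr0. Qed.

Lemma node_root M j : (j < M)%N -> root (sine_poly M) (tan (node M j) ^+ 2).
Proof.
move=> ltjM; have c0 := lt0r_neq0 (node_cos_gt0 ltjM).
have s0 := lt0r_neq0 (node_sin_gt0 ltjM).
have := sine_polyP M c0; rewrite -mulr_natr divfK ?pnatr_eq0 //.
rewrite mulr_natl sin_natpi => /esym/eqP; rewrite !mulf_eq0 (negPf s0) /=.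
by rewrite expf_eq0 (negPf c0) andbF.
Qed.

Lemma node_inj M : {in gtn M &, injective (fun j => tan (node M j) ^+ 2)}.
Proof.
move=> j k; rewrite !inE => lj lk /eqP.
have tpos i : (i < M)%N -> 0 <= tan (node M i).
  by move=> li; rewrite divr_ge0 ?ltW ?node_cos_gt0 ?node_sin_gt0.
rewrite eqrXn2 ?tpos // => /eqP /tan_inj; rewrite !in_itv /=.
have pi0 := @pi_gt0 R; have hj := node_itv lj; have hk := node_itv lk.
move=> /(_ ltac:(lra) ltac:(lra)); rewrite /node.
move=> /(mulIf _) /= h; apply/eqP; rewrite -eqSS -(eqr_nat R).
by apply/eqP/(mulIf (lt0r_neq0 pi0))/h; rewrite invr_eq0 pnatr_eq0.
Qed.

(** cot^2 of the node. *)
Definition cot2 (M j : nat) : R := (tan (node M j) ^+ 2)^-1.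

(** The M distinct roots tan^2 of the nodes split the polynomial; its constant term
2M + 1 fixes the scalar factor. *)
Lemma sine_poly_factor M :
  sine_poly M = M.*2.+1%:R *: \prod_(j < M) (1 - (cot2 M j)%:P * 'X).
Proof.
pose rs := [seq tan (node M j) ^+ 2 | j <- index_iota 0 M].
have szQ : size (sine_poly M) = M.+1.
  by rewrite size_poly_eq // mulf_neq0 ?expf_neq0 ?oppr_eq0 ?oner_eq0 // binn oner_eq0.
have rQ : all (root (sine_poly M)) rs.
  by apply/allP => _ /mapP[j + ->]; rewrite mem_index_iota => /andP[_ lj]; apply: node_root.
have urs : uniq_roots rs.
  rewrite uniq_rootsE map_inj_in_uniq ?iota_uniq // => j k; rewrite !mem_index_iota.
  by move=> /andP[_ lj] /andP[_ lk]; apply: node_inj.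
have tN0 (j : 'I_M) : tan (node M j) ^+ 2 != 0.
  by rewrite expf_neq0 // mulf_neq0 ?invr_eq0 ?lt0r_neq0 ?node_cos_gt0 ?node_sin_gt0.
have := all_roots_prod_XsubC _ rQ urs; rewrite size_map size_iota subn0 szQ => /(_ erefl).
set l := lead_coef _; rewrite big_map big_mkord => QE.
have PE : \prod_(j < M) ('X - (tan (node M j) ^+ 2)%:P) =
   (\prod_(j < M) (- tan (node M j) ^+ 2)) *: \prod_(j < M) (1 - (cot2 M j)%:P * 'X).
  rewrite -scaler_prod; apply: eq_bigr => j _.
  rewrite scalerBr alg_polyC -mul_polyC mulrA -polyCM mulNr divff //.
  by rewrite rmorphN rmorphN1; ring.
rewrite QE PE scalerA; congr (_ *: _).
have : (sine_poly M)`_0 = M.*2.+1%:R by rewrite coef_poly /= expr0 mul1r bin1.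
rewrite QE PE scalerA coefZ => <-.
rewrite -horner_coef0 horner_prod [X in _ = _ * X]big1 ?mulr1 // => j _.
by rewrite !hornerE ?mulr0 ?subr0.
Qed.

(** The logarithmic derivative of 1 - x u is - \sum_(r >= 1) x^r u^r. *)
Lemma newton_linear (x : R) :
  newton (fun k => (1 - x%:P * 'X)`_k) (fun r => - x ^+ r).
Proof.
have E : forall m, ((m == 0)%N%:R : R) =
    \sum_(i < m.+1) x ^+ i * (1 - x%:P * 'X)`_(m - i).
  apply: (geometric_conv (b := fun k => (1 - x%:P * 'X)`_k)
    (c := fun m => (m == 0)%N%:R)) => [|k].
    by rewrite coefB coefC coefCM coefX mulr0 subr0.
  rewrite coefB coefC coefCM coefX; case: k => [|k];
    by rewrite ?mulr1 ?mulr0 ?subr0 ?addr0 ?sub0r ?addNr.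
have N0 : newton (fun m => (m == 0)%N%:R) (fun=> 0 : R).
  by case=> [|k]; rewrite ?big_ord0 ?mul0rn // big1 // => i _; rewrite mul0r.
have := newton_div (expr0 _) E (newton_geometric x) N0.
by apply: eq_newton => // r _; rewrite sub0r.
Qed.

(** The power sums of the cot^2 (j pi / N) / N^2, where N = 2M + 1. *)
Definition cot_powers (M r : nat) : R :=
  \sum_(j < M) (cot2 M j / M.*2.+1%:R ^+ 2) ^+ r.

(** The elementary symmetric functions, with alternating signs, of the
cot^2 (j pi / N) / N^2, where N = 2M + 1. *)
Definition cot_elem (M k : nat) : R :=
  (-1) ^+ k * 'C(M.*2.+1, k.*2.+1)%:R / M.*2.+1%:R ^+ k.*2.+1.

Lemma newton_cot M : newton (cot_elem M) (fun r => - cot_powers M r).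
Proof.
set N := M.*2.+1; have N0 : N%:R != 0 :> R by rewrite pnatr_eq0.
have Np : newton (fun k => (\prod_(j < M) (1 - (cot2 M j)%:P * 'X))`_k)
    (fun r => - \sum_(j < M) cot2 M j ^+ r).
  apply/newton_dlog => d.
  have D (j : 'I_M) := (newton_dlog _ _).1 (newton_linear (cot2 M j)) d.
  apply: eq_dlog (dlog_prod (index_enum _) D) => m lem.
    rewrite coef_tpoly //; apply: (@eq_coef_prod _ m) => // i l lel.
    by rewrite coef_tpoly // (leq_trans lel).
  rewrite coef_sum coef_tpoly0 //; under eq_bigr do rewrite coef_tpoly0 //.
  by case: eqP => _; [rewrite big1 | rewrite sumrN].
have := newton_scale ((N%:R ^+ 2)^-1) Np.
apply: eq_newton => [k|r _].
  have -> : (\prod_(j < M) (1 - (cot2 M j)%:P * 'X))`_k =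
      (-1) ^+ k * 'C(N, k.*2.+1)%:R / N%:R.
    apply: (mulfI N0); rewrite -coefZ -sine_poly_factor coef_poly.
    rewrite [RHS]mulrC mulfVK //; case: ltnP => // ge.
    by rewrite bin_small ?mulr0 // /N; lia.
  rewrite /cot_elem -/N exprVn -exprM exprS mul2n.
  by field; rewrite N0 expf_neq0.
rewrite mulrN /cot_powers mulr_sumr; congr (- _); apply: eq_bigr => j _.
by rewrite exprMn mulrC.
Qed.

Lemma cot_elem0 M : cot_elem M 0 = 1.
Proof. by rewrite /cot_elem bin1 mul1r divff // pnatr_eq0. Qed.

Lemma cvg_invN : (fun M => (M.*2.+1%:R : R)^-1) @ \oo --> (0 : R).
Proof.
apply: (@squeeze_cvgr _ _ _ _ (fun=> 0) harmonic); last 2 first.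
- exact: cvg_cst.
- exact: cvg_harmonic.
apply: nearW => M; rewrite invr_ge0 ler0n /= lef_pV2 ?posrE ?ltr0n // ler_nat; lia.
Qed.

Lemma cvg_ffact m :
  (fun M => (M.*2.+1 ^_ m)%:R / M.*2.+1%:R ^+ m : R) @ \oo --> (1 : R).
Proof.
elim: m => [|m IHm].
  by under eq_fun do rewrite ffactn0 expr0 divr1; apply: cvg_cst.
have -> : (fun M => (M.*2.+1 ^_ m.+1)%:R / M.*2.+1%:R ^+ m.+1 : R) =
    (fun M => ((M.*2.+1 ^_ m)%:R / M.*2.+1%:R ^+ m : R) *
              ((M.*2.+1 - m)%N%:R / M.*2.+1%:R)).
  apply/funext => M; rewrite ffactnSr natrM exprSr invfM.
  by rewrite mulrACA [X in _ * X]mulrC.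
rewrite -[X in _ --> X]mulr1; apply: cvgM; first exact: IHm.
apply: (@squeeze_cvgr _ _ _ _ (fun M => 1 - m%:R * (M.*2.+1%:R)^-1) (fun=> 1)).
- apply: nearW => M; have N0 : 0 < M.*2.+1%:R :> R by rewrite ltr0n.
  rewrite ler_pdivlMr // mulrBl mul1r mulfVK ?lt0r_neq0 //.
  rewrite ler_pdivrMr // mul1r ler_nat leq_subr andbT.
  by rewrite lerBlDr -natrD ler_nat; lia.
- rewrite -[X in _ --> X]subr0; apply: cvgB; first exact: cvg_cst.
  by rewrite -(mulr0 m%:R); apply: cvgMl_tmp; apply: cvg_invN.
exact: cvg_cst.
Qed.

Lemma cvg_cot_elem k : cot_elem ^~ k @ \oo --> ((-1) ^+ k * ratr (sinhc k) : R).
Proof.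
have -> : cot_elem ^~ k = fun M => (-1) ^+ k * (k.*2.+1`!%:R)^-1 *
    ((M.*2.+1 ^_ k.*2.+1)%:R / M.*2.+1%:R ^+ k.*2.+1).
  apply/funext => M; rewrite /cot_elem -bin_ffact natrM.
  have f0 : k.*2.+1`!%:R != 0 :> R by rewrite pnatr_eq0 -lt0n fact_gt0.
  by field; rewrite f0 expf_neq0 ?pnatr_eq0.
rewrite /sinhc fmorphV /= rmorph_nat -[X in _ --> X]mulr1.
by apply: cvgMl_tmp; apply: cvg_ffact.
Qed.

(** The value of pi^(-2r) zeta(2r). *)
Definition zeta_pi (r : nat) : R := - (-1) ^+ r * ratr (4 ^+ r * bnum r / 2).

(** The elementary symmetric functions tend to (-1)^k / (2k + 1)!, so that Newton's
identities give the limits of the power sums by [newton_sinhc]. *)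
Lemma cvg_cot_powers r : (0 < r)%N -> cot_powers ^~ r @ \oo --> (zeta_pi r : R).
Proof.
move=> r0; have Nb := newton_scale (-1) (newton_map (ratr : {rmorphism rat -> R}) newton_sinhc).
have := cvg_newton_powers newton_cot Nb cot_elem0 _ cvg_cot_elem r0.
rewrite mul1r rmorph1 => /(_ erefl) /cvgN.
rewrite /zeta_pi mulNr (_ : - _ = cot_powers ^~ r) //.
by apply/funext => M /=; rewrite -[LHS]/(- - cot_powers M r) opprK.
Qed.

Lemma inv_node_bounds M j : (j < M)%N ->
  cot2 M j <= (node M j ^+ 2)^-1 <= 1 + cot2 M j.
Proof.
move=> lj; have s0 := node_sin_gt0 lj; have c0 := node_cos_gt0 lj.
have /andP[l u] := sin_between (node_itv lj); have /andP[x0 _] := node_itv lj.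
rewrite /cot2 /tan; move: (node M j) s0 c0 l u x0 => x s0 c0 l u x0.
have -> : ((sin x / cos x) ^+ 2)^-1 = (cos x ^+ 2) / sin x ^+ 2.
  by rewrite expr_div_n invf_div.
have s2 : 0 < sin x ^+ 2 by rewrite exprn_gt0.
have x2 : 0 < x ^+ 2 by rewrite exprn_gt0.
have -> : 1 + cos x ^+ 2 / sin x ^+ 2 = (sin x ^+ 2)^-1.
  by rewrite cos2sin2 mulrBl mul1r divff ?lt0r_neq0 // addrC subrK.
apply/andP; split; last first.
  by rewrite lef_pV2 ?posrE // ler_pXn2r // nnegrE ltW.
rewrite ler_pdivrMr // mulrC ler_pdivlMr // mulrC -exprMn.
by rewrite ler_pXn2r // nnegrE ltW // mulr_gt0.
Qed.

(** The partial sums of zeta(2r). *)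
Definition zeta_sum (r M : nat) : R := \sum_(j < M) (j.+1%:R ^+ (2 * r))^-1.

Lemma cvg_cot_powers_small i :
  (fun M => (M.*2.+1%:R ^+ 2)^-1 * cot_powers M i) @ \oo --> (0 : R).
Proof.
case: i => [|i]; last first.
  rewrite -(mul0r (zeta_pi i.+1)); apply: cvgM; last exact: cvg_cot_powers.
  under eq_fun do rewrite expr2 invfM.
  by rewrite -(mul0r 0); apply: cvgM; apply: cvg_invN.
apply: (@squeeze_cvgr _ _ _ _ (fun=> 0) (fun M => (M.*2.+1%:R)^-1)).
- apply: nearW => M; rewrite /cot_powers.
  under eq_bigr do rewrite expr0.
  rewrite sumr_const card_ord mulr_ge0 ?invr_ge0 ?exprn_ge0 ?ler0n //=.
  rewrite expr2 invfM -mulrA ler_piMr ?invr_ge0 ?ler0n // mulrC.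
  by rewrite ler_pdivrMr ?ltr0n // mul1r ler_nat; lia.
- exact: cvg_cst.
exact: cvg_invN.
Qed.

(** The added term 1 / N^2 disappears in the limit: in the binomial expansion every
term but the last carries a positive power of 1 / N^2. *)
Lemma cvg_shifted_powers r : (0 < r)%N ->
  (fun M => \sum_(j < M) ((M.*2.+1%:R ^+ 2)^-1 + cot2 M j / M.*2.+1%:R ^+ 2) ^+ r)
    @ \oo --> (zeta_pi r : R).
Proof.
move=> r0; pose h M : R := (M.*2.+1%:R ^+ 2)^-1.
have -> : (fun M => \sum_(j < M) ((M.*2.+1%:R ^+ 2)^-1 + cot2 M j / M.*2.+1%:R ^+ 2) ^+ r)
  = (fun M => (\sum_(i < r) h M ^+ (r - i) * cot_powers M i *+ 'C(r, i)) + cot_powers M r).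
  apply/funext => M.
  transitivity (\sum_(i < r.+1) h M ^+ (r - i) * cot_powers M i *+ 'C(r, i)).
    under eq_bigr do rewrite exprDn.
    rewrite exchange_big /=; apply: eq_bigr => i _.
    by rewrite mulr_sumr -sumrMnl.
  by rewrite big_ord_recr /= subnn mul1r binn.
rewrite -(add0r (zeta_pi r)); apply: cvgD; last exact: cvg_cot_powers.
rewrite -[X in _ --> X](@big1_eq _ 0 +%R _ (index_enum 'I_r) xpredT).
apply: (cvg_sum_ord (f := fun i M => h M ^+ (r - i) * cot_powers M i *+ 'C(r, i))
  (l := fun=> 0)) => i ltir.
rewrite -(mul0rn _ 'C(r, i)); apply: cvgMn.
have -> : (r - i = (r - i.+1).+1)%N by lia.
have h0 : h @ \oo --> (0 : R).
  rewrite /h; under eq_fun do rewrite expr2 invfM.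
  by rewrite -(mul0r 0); apply: cvgM; apply: cvg_invN.
elim: (r - i.+1)%N => [|d IHd]; first by under eq_fun do rewrite expr1; apply: cvg_cot_powers_small.
under eq_fun do rewrite exprS -mulrA.
by rewrite -(mul0r 0); apply: cvgM.
Qed.

Lemma cvg_zeta_sum r : (0 < r)%N ->
  zeta_sum r @ \oo --> (pi ^+ (2 * r) * zeta_pi r : R).
Proof.
move=> r0; have pi0 := @pi_gt0 R.
have -> : zeta_sum r = (fun M => pi ^+ (2 * r) *
   \sum_(j < M) ((node M j ^+ 2)^-1 / M.*2.+1%:R ^+ 2) ^+ r).
  apply/funext => M; rewrite /zeta_sum mulr_sumr; apply: eq_bigr => j _.
  rewrite -invfM -exprMn /node divfK ?pnatr_eq0 // exprVn -exprM exprMn invfM.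
  by rewrite mulrCA divff ?mulr1 // expf_neq0 // lt0r_neq0.
apply: cvgMl_tmp.
(* cot^2 x <= 1 / x^2 <= 1 + cot^2 x at the nodes, divided by N^2. *)
apply: (@squeeze_cvgr _ _ _ _ (cot_powers ^~ r) (fun M => \sum_(j < M)
   ((M.*2.+1%:R ^+ 2)^-1 + cot2 M j / M.*2.+1%:R ^+ 2) ^+ r)); last 2 first.
- exact: cvg_cot_powers.
- exact: cvg_shifted_powers.
apply: nearW => M; have N0 : 0 < M.*2.+1%:R ^+ 2 :> R by rewrite exprn_gt0 ?ltr0n.
have c0 j : 0 <= cot2 M j by rewrite invr_ge0 sqr_ge0.
apply/andP; split; apply: ler_sum => j _;
    have /andP[l u] := inv_node_bounds (ltn_ord j).
  have ? : 0 <= cot2 M j / M.*2.+1%:R ^+ 2 by rewrite divr_ge0 // ltW.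
  by rewrite lerXn2r ?nnegrE ?divr_ge0 ?invr_ge0 ?sqr_ge0 ?(ltW N0) // ler_pM2r ?invr_gt0.
rewrite lerXn2r ?nnegrE ?addr_ge0 ?divr_ge0 ?invr_ge0 ?sqr_ge0 ?(ltW N0) //.
by rewrite -[X in X + _]mul1r -mulrDl ler_pM2r ?invr_gt0.
Qed.

Lemma zeta_sumS r M : zeta_sum r M.+1 = zeta_sum r M + (M.+1%:R ^+ (2 * r))^-1.
Proof. by rewrite /zeta_sum big_ord_recr. Qed.

(** The even terms are 4^-r times the terms of the sum up to N / 2. *)
Lemma alternating_zeta_sum r N :
  \sum_(1 <= x < N.+1) (-1) ^+ x * (x%:R ^+ (2 * r))^-1 =
  2 / 4 ^+ r * zeta_sum r N./2 - zeta_sum r N :> R.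
Proof.
elim: N => [|N IHN].
  by rewrite big_geq // /zeta_sum !big_ord0 mulr0 subr0.
rewrite big_nat_recr //= IHN zeta_sumS.
rewrite uphalf_half -signr_odd /=.
have [oN|eN] := boolP (odd N); last by rewrite /= expr1; ring.
rewrite /= add1n zeta_sumS.
have -> : (N.+1 = 2 * N./2.+1)%N by have := odd_double_half N; rewrite oN; lia.
have -> : ((2 * N./2.+1)%N%:R : R) ^+ (2 * r) = 4 ^+ r * N./2.+1%:R ^+ (2 * r).
  by rewrite natrM exprMn (_ : 4 = 2 ^+ 2) -?exprM // -natrX.
by rewrite invfM expr0 mul1r; ring.
Qed.

Lemma cvg_half : half @ \oo --> \oo.
Proof.
by apply/cvgnyPge => A; exists A.*2 => // n /= len; rewrite geq_half_double.
Qed.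

(** The alternating sum is (2^(1-2r) - 1) zeta(2r). *)
Lemma cvg_alternating_zeta r : (0 < r)%N ->
  (fun N => \sum_(1 <= x < N.+1) (-1) ^+ x * (x%:R ^+ (2 * r))^-1) @ \oo -->
  ((- pi ^+ 2) ^+ r * ratr (nu (2 * r) * bnum r) : R).
Proof.
move=> r0; under eq_fun do rewrite alternating_zeta_sum.
have -> : (- pi ^+ 2) ^+ r * ratr (nu (2 * r) * bnum r) =
   2 / 4 ^+ r * (pi ^+ (2 * r) * zeta_pi r) - pi ^+ (2 * r) * zeta_pi r :> R.
  have e2 : 2 ^+ (2 * r).-1 = 4 ^+ r / 2 :> rat.
    have -> : 4 = 2 ^+ 2 :> rat by [].
    by rewrite -exprM -[in RHS](prednK (_ : 0 < 2 * r)%N) ?muln_gt0 // exprSr mulfK.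
  have four : 4 ^+ r != 0 :> R by rewrite expf_neq0 // pnatr_eq0.
  rewrite /nu e2 /zeta_pi [(- pi ^+ 2) ^+ r]exprNn -exprM.
  rewrite !(rmorphM, rmorphB) !rmorphXn !fmorphV rmorph1 !rmorph_nat.
  by field; rewrite four pnatr_eq0 -lt0n fact_gt0.
apply: (@cvgB _ R _ _ _ (fun N => 2 / 4 ^+ r * zeta_sum r N./2) (zeta_sum r));
  last exact: cvg_zeta_sum.
apply: cvgMl_tmp; apply: (cvg_comp _ _ cvg_half); exact: cvg_zeta_sum.
Qed.

End Cotangent.

Local Open Scope complex_scope.

(** * The partial alternating multiple zeta values *)

(** The rational numbers (-pi^2)^(-nr) \sum_i (-1)^i / i^(2nr). *)
Definition eta_power (n r : nat) : rat := nu (2 * (n * r)) * bnum (n * r).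

(** The truncated sums satisfy Newton's identities, hence so do their limits. *)
Lemma cvg_pamzv_partial (R : realType) (n k : nat) : (0 < n)%N ->
  pamzv_partial R k (2 * n) @ \oo -->
  ((- pi ^+ 2) ^+ (n * k) * ratr (cycle_index (eta_power n) k) : R).
Proof.
move=> n_gt0.
have Nb := newton_scale ((- pi ^+ 2) ^+ n)
  (newton_map (ratr : {rmorphism rat -> R}) (newton_cycle_index (eta_power n))).
rewrite exprM; apply: (cvg_newton_coef (@newton_pamzv_partial R (2 * n)) Nb) => [N|r r_gt0].
  by rewrite pamzv_partial0 cycle_index0 rmorph1 mulr1.
rewrite -exprM /eta_power; under eq_fun do under eq_bigr do rewrite exprVn -exprM -mulnA.
by apply: cvg_alternating_zeta; rewrite muln_gt0 n_gt0.
Qed.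

Lemma fsbig_partitions (V : nmodType) d (F : seq nat -> V) :
  \sum_(la \in [set la | is_partition d la]) F la = \sum_(la <- parts d) F la.
Proof.
rewrite [RHS]fsbig_seq ?parts_uniq //; congr (\sum_(la \in _) F la).
by apply/seteqP; split=> la /=; rewrite mem_parts.
Qed.

Lemma fsbig_short_partitions (V : nmodType) d n (F : seq nat -> V) :
  \sum_(la \in [set la | is_partition d la /\ (size la <= n)%N]) F la =
  \sum_(la <- parts d | (size la <= n)%N) F la.
Proof.
rewrite -[RHS]big_filter [RHS]fsbig_seq ?filter_uniq ?parts_uniq //.
congr (\sum_(la \in _) F la).
by apply/seteqP; split=> la /=; rewrite mem_filter mem_parts andbC => /andP.
Qed.

Lemma part_ratioE q la : bernoulli_part (scale_part (2 * q) la) /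
    (fact_part (scale_part (2 * q) la))%:R = \prod_(i <- la) bnum (q * i) :> rat.
Proof.
rewrite /bernoulli_part /fact_part /scale_part !big_map natr_prod -prodf_div.
by apply: eq_bigr => i _; rewrite /bnum mulnA.
Qed.

Theorem theorem3p3 (R : realType) (n k : nat) (n_gt0 : (0 < n)%N)
    (k_gt0 : (0 < k)%N) :
  [/\ cvgn (pamzv_partial R k (2 * n)),
      forall omega : R[i], n.-primitive_root omega ->
        (pamzv R k (2 * n))%:C =
        ((- pi ^+ 2) ^+ (n * k))%:C *
        \sum_(m : {ffun 'I_n -> 'I_(n * k).+1} | (\sum_i m i)%N == (n * k)%N)
          omega ^+ (\sum_(i < n) i.+1 * m i)%N *
          \prod_(i < n) ratr (bernoulli (2 * m i) / ((2 * m i)`!)%:R),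
      forall sp, standard_scalar_product sp ->
        pamzv R k (2 * n) =
        (- pi ^+ 2) ^+ (n * k) *
        \sum_(la \in [set la | is_partition (n * k) la /\ (size la <= n)%N])
          (ratr (sp (SymFun.plethysm_p n (SymFun.h k)) (SymFun.mpart la) *
                 (bernoulli_part (scale_part 2 la) /
                  (fact_part (scale_part 2 la))%:R)) : R)
    & pamzv R k (2 * n) =
        (- pi ^+ 2) ^+ (n * k) *
        \sum_(mu \in [set mu | is_partition k mu])
          (ratr (nu_part (scale_part (2 * n) mu) / (zee mu)%:R *
                 (bernoulli_part (scale_part (2 * n) mu) /
                  (fact_part (scale_part (2 * n) mu))%:R)) : R)].
Proof.
have lim := @cvg_pamzv_partial R n k n_gt0.
have SE : pamzv R k (2 * n) = (- pi ^+ 2) ^+ (n * k) * ratr (cycle_index (eta_power n) k).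
  exact: cvg_lim lim.
split=> [|omega prim|sp spP|].
- by apply/cvg_ex; eexists; apply: lim.
- rewrite SE rmorphM; congr (_ * _); rewrite fmorph_rat.
  have Nb := newton_map (ratr : {rmorphism rat -> R[i]}) newton_bnum.
  have Nf := newton_map (ratr : {rmorphism rat -> R[i]}) (newton_cycle_index (eta_power n)).
  have := root_of_unity_product k (@torsion_free_num _) n_gt0
    (fun r => sum_unity_powers r prim) Nb _ Nf _.
  by rewrite bnum0 cycle_index0 rmorph1 => /(_ erefl erefl) <-.
- rewrite SE fsbig_short_partitions -rmorph_sum; congr (_ * ratr _).
  under eq_bigr do rewrite (part_ratioE 1).
  under eq_bigr do under eq_bigr do rewrite mul1n.
  by rewrite (SymFunTheory.scalar_product_formula k n_gt0 spP newton_bnum bnum0).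
rewrite SE fsbig_partitions -rmorph_sum; congr (_ * ratr _).
apply: eq_bigr => mu _; rewrite part_ratioE mulrAC /nu_part /scale_part big_map -big_split.
by congr (_ / _); apply: eq_bigr => i _; rewrite /eta_power mulnA.
Qed.
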